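(* For every integer $n\ge 2$ and every $A\in\Omega_n$ (the set of $n\times n$ doubly stochastic matrices), $$\operatorname{per}A\ \ge\ \operatorname{per}\tau_n(A),\qquad \tau_n(A)=\frac{nJ_n-A}{n-1}.$$ Moreover, the matrices $A\in\Omega_n$ for which equality holds are exactly the following: (1) if $n=2$, every $A\in\Omega_2$; (2) if $n=3$, the matrix $J_3$ and the six matrices $(\mathbf 1\mathbf 1^{\mathsf T}-P)/2$, where $P$ ranges over the $3\times 3$ permutation matrices; (3) if $n\ge 4$, only $A=J_n$.
   Context: For an $n\times n$ matrix $D=(d_{ij})$, the permanent is $\operatorname{per}D=\sum_{\pi\in S_n}\prod_{i=1}^n d_{i,\pi(i)}$, where $S_n$ is the set of all permutations of $\{1,\dots,n\}$. $\Omega_n$ denotes the set of real $n\times n$ doubly stochastic matrices: all entries are nonnegative and every row sum and every column sum equals $1$. $\mathbf 1$ is the all-ones column vector, and $J_n=\frac1n\mathbf 1\mathbf 1^{\mathsf T}$ is the $n\times n$ matrix with every entry $1/n$. The Marcus--Minc transform $\tau_n:\Omega_n\to\Omega_n$ is $\tau_n(A)=(nJ_n-A)/(n-1)$. A permutation matrix is a zero--one matrix with exactly one $1$ in each row and each column. *)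

(* Defs.v *)
From HB Require Import structures.
From mathcomp Require Import all_boot all_order all_algebra all_fingroup.
From mathcomp Require Import reals.

Set Implicit Arguments.
Unset Strict Implicit.
Unset Printing Implicit Defensive.

Import Order.TTheory GRing.Theory Num.Theory.
Local Open Scope ring_scope.

Definition permanent (R : comPzRingType) (n : nat) (D : 'M[R]_n) : R :=
  \sum_(s : 'S_n) \prod_(i < n) D i (s i).

Definition doubly_stochastic (R : numDomainType) (n : nat) (A : 'M[R]_n) : Prop :=
  [/\ forall i j, 0 <= A i j,
      forall i, \sum_(j < n) A i j = 1
    & forall j, \sum_(i < n) A i j = 1].

Definition ones (R : pzRingType) (n : nat) : 'cV[R]_n := const_mx 1.

Definition Jmx (R : fieldType) (n : nat) : 'M[R]_n :=
  n%:R^-1 *: (ones R n *m (ones R n)^T).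

Definition marcus_minc (R : fieldType) (n : nat) (A : 'M[R]_n) : 'M[R]_n :=
  (n%:R - 1)^-1 *: (n%:R *: Jmx R n - A).

Lemma JmxE (R : fieldType) (n : nat) (i j : 'I_n) : Jmx R n i j = n%:R^-1.
Proof. by rewrite !mxE big_ord1 !mxE !mulr1. Qed.

Lemma marcus_mincE (R : numFieldType) (n : nat) (A : 'M[R]_n) (i j : 'I_n) :
  marcus_minc A i j = (n%:R - 1)^-1 * (1 - A i j).
Proof.
have n_neq0 : n%:R != 0 :> R by rewrite pnatr_eq0 -lt0n (leq_trans _ (ltn_ord i)).
by rewrite !mxE big_ord1 !mxE !mulr1 divff.
Qed.

Lemma marcus_minc_doubly_stochastic (R : realFieldType) (n : nat)
    (hn : (2 <= n)%N) (A : 'M[R]_n) :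
  doubly_stochastic A -> doubly_stochastic (marcus_minc A).
Proof.
move=> [A_ge0 rowA colA].
have n1_gt0 : 0 < n%:R - 1 :> R by rewrite subr_gt0 ltr1n.
have sum1 (f : 'I_n -> R) :
    \sum_i f i = 1 -> \sum_i (n%:R - 1)^-1 * (1 - f i) = 1.
  move=> sumf; rewrite -mulr_sumr sumrB sumf sumr_const card_ord.
  by rewrite mulVf // gt_eqF.
split=> [i j|i|j].
- rewrite marcus_mincE pmulr_rge0 ?invr_gt0 // subr_ge0.
  rewrite -(rowA i) (bigD1 j) //= lerDl.
  by apply: sumr_ge0 => k _; apply: A_ge0.
- by rewrite -[RHS](sum1 (A i) (rowA i)); apply: eq_bigr => j _; rewrite marcus_mincE.
- by rewrite -[RHS](sum1 (A^~ j) (colA j)); apply: eq_bigr => i _; rewrite marcus_mincE.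
Qed.

(* Main.v *)
Require Import Defs.
From mathcomp Require Import normedtype sequences derive realfun.
From mathcomp Require Import exp polyrcf.
From mathcomp Require Import all_boot all_order all_algebra all_fingroup.
From mathcomp Require Import reals.
From mathcomp Require Import ring lra.

Set Implicit Arguments.
Unset Strict Implicit.
Unset Printing Implicit Defensive.

Import Order.TTheory GRing.Theory Num.Theory.
Import numFieldNormedType.Exports.
Local Open Scope ring_scope.

(** Write [m = n! / n^n], [J] for the constant matrix, [E = A - J] and [B = marcus_minc A], so that
    [B = J - E / (n - 1)].

    Lower bound. The Alexandrov-Fenchel inequality for permanents feeds Gurvits' capacity argument.
    Singling out a row [b] it gives
    [per A >= (n-1)! / (n-1)^(n-1) * exp (sum_j (1 - b_j) ln (1 - b_j))], a van der Waerden bound with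
    an entropy term; estimating the entropy and averaging over the rows yields
    [per A >= m (1 + |E|^2 / (2 n - 1))].

    Upper bound. Along the segment from [J] to [B] the derivative of the permanent is a sum of the
    quadratic forms [- per (D, D, other rows)] at the row differences [D]. Since [D] has zero sum, such
    a form is controlled by the spread of the (n-2)-minors, which lie between a van der Waerden and a
    Bonferroni bound. For [n >= 5] the resulting estimate of [per B] is below the lower bound for
    [per A] unless [E = 0].

    For [n = 4] the identity [81 per B - per A = 15/2 + |E|^2 / 2 - 2/3 sum E_ij^3] reduces the claim to
    the lower bound; for [n = 3] the difference [4 (per A - per B)] is the sum over the rows of Schur's
    expression, whose zeros are [(1/3, 1/3, 1/3)] and the permutations of [(0, 1/2, 1/2)]. *)

(** * Permanents of row lists as symmetric multilinear forms *)

(* For [size rs = #|S|] this is the permanent of the square matrix with rows [rs] and columns [S];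
   for shorter [rs] it is the sum over injections of the rows into [S]. *)
Fixpoint rper (R : comPzRingType) (n : nat) (rs : seq 'rV[R]_n)
    (S : {set 'I_n}) : R :=
  if rs is x :: rs' then \sum_(j in S) x 0 j * rper rs' (S :\ j) else 1.

(** Expanding along both rows gives a sum over ordered pairs of distinct columns, and the swap
    exchanges the two summations. *)
Lemma rper_swap (R : comPzRingType) n (x y : 'rV[R]_n) rs S :
  rper (x :: y :: rs) S = rper (y :: x :: rs) S.
Proof.
rewrite /=.
under eq_bigr do rewrite big_distrr /=.
under [RHS]eq_bigr do rewrite big_distrr /=.
rewrite (exchange_big_dep (mem S)) /=; last first.
  by move=> i j _; rewrite in_setD1 => /andP[].
apply: eq_bigr => j jS; apply: eq_big => [i|i /andP[iS ijS]].
  by rewrite !in_setD1 jS andbT eq_sym andbC.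
rewrite mulrCA; congr (_ * (_ * rper _ _)).
by rewrite !setDDl setUC.
Qed.

Lemma rper_perm (R : comPzRingType) n (rs rs' : seq 'rV[R]_n) S :
  perm_eq rs rs' -> rper rs S = rper rs' S.
Proof.
have rper_mid (us vs : seq 'rV[R]_n) x T :
    rper (us ++ x :: vs) T = rper (x :: us ++ vs) T.
  elim: us T => [//|u us IH] T.
  by rewrite [RHS]rper_swap /=; apply: eq_bigr => j _; rewrite IH.
elim: rs rs' S => [|x rs IH] rs' S.
  by rewrite perm_sym => /perm_nilP->.
move=> eq_rs; have x_rs' : x \in rs' by rewrite -(perm_mem eq_rs) mem_head.
case/splitPr: rs' / x_rs' eq_rs => us vs.
rewrite perm_sym perm_catC cat_cons perm_cons perm_catC perm_sym => eq_rs.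
by rewrite rper_mid /=; apply: eq_bigr => j _; rewrite (IH _ _ eq_rs).
Qed.

Lemma rper_linear (R : comPzRingType) n (x y : 'rV[R]_n) a rs S :
  rper (a *: x + y :: rs) S = a * rper (x :: rs) S + rper (y :: rs) S.
Proof.
rewrite /= big_distrr -big_split /=; apply: eq_bigr => j _.
by rewrite !mxE mulrDl mulrA.
Qed.

Lemma rperZ (R : comPzRingType) n (x : 'rV[R]_n) a rs S :
  rper (a *: x :: rs) S = a * rper (x :: rs) S.
Proof.
by rewrite /= big_distrr /=; apply: eq_bigr => j _; rewrite !mxE mulrA.
Qed.

Lemma rperD (R : comPzRingType) n (x y : 'rV[R]_n) rs S :
  rper (x + y :: rs) S = rper (x :: rs) S + rper (y :: rs) S.
Proof. by rewrite -[x]scale1r rper_linear scale1r mul1r. Qed.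

Lemma rper0 (R : comPzRingType) n rs (S : {set 'I_n}) :
  rper ((0 : 'rV[R]_n) :: rs) S = 0.
Proof. by rewrite -(scale0r 0) rperZ mul0r. Qed.

Lemma rper_sum (R : comPzRingType) n I (r : seq I) (P : pred I)
    (x : I -> 'rV[R]_n) rs S :
  rper (\sum_(i <- r | P i) x i :: rs) S = \sum_(i <- r | P i) rper (x i :: rs) S.
Proof.
apply: (big_morph (fun v => rper (v :: rs) S)); last exact: rper0.
by move=> u v; rewrite rperD.
Qed.

Lemma rperZ_all (R : comPzRingType) n a (rs : seq 'rV[R]_n)
    (S : {set 'I_n}) :
  rper [seq a *: x | x <- rs] S = a ^+ size rs * rper rs S.
Proof.
elim: rs S => [|x rs IH] S; first by rewrite /= mul1r.
rewrite map_cons rperZ /= exprS -mulrA; congr (_ * _).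
rewrite big_distrr /=; apply: eq_bigr => j _; rewrite IH.
by rewrite mulrCA.
Qed.

Lemma rper_map (R R' : comPzRingType) (f : {rmorphism R -> R'}) n
    (rs : seq 'rV[R]_n)
    (S : {set 'I_n}) :
  f (rper rs S) = rper [seq map_mx f x | x <- rs] S.
Proof.
elim: rs S => [|x rs IH] S /=; first by rewrite rmorph1.
by rewrite rmorph_sum; apply: eq_bigr => j _; rewrite rmorphM IH mxE.
Qed.

Lemma rper_eq_in (R : comPzRingType) n I (s : seq I) (x y : I -> 'rV[R]_n)
    (S : {set 'I_n}) :
  (forall i j, j \in S -> x i 0 j = y i 0 j) ->
  rper (map x s) S = rper (map y s) S.
Proof.
elim: s S => [//|i s IH] S eq_xy /=; apply: eq_bigr => j jS.
by rewrite eq_xy // IH // => k l /setD1P[_ lS]; apply: eq_xy.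
Qed.

(** Positivity is asked on [S] only, so that it passes to the smaller column sets met in
    inductions. *)
Definition posrow (R : numDomainType) n (S : {set 'I_n}) (x : 'rV[R]_n) : Prop :=
  forall j, j \in S -> 0 < x 0 j.

Lemma posrowS (R : numDomainType) n (S T : {set 'I_n}) (x : 'rV[R]_n) :
  T \subset S -> posrow S x -> posrow T x.
Proof. by move=> /subsetP TS xS j /TS; apply: xS. Qed.

Lemma rper_ge0 (R : numDomainType) n (rs : seq 'rV[R]_n)
    (S : {set 'I_n}) :
  (forall x, x \in rs -> forall j, j \in S -> 0 <= x 0 j) -> 0 <= rper rs S.
Proof.
elim: rs S => [|x rs IH] S rs_ge0 //=.
apply: sumr_ge0 => j jS; apply: mulr_ge0; first exact/rs_ge0/jS/mem_head.
apply: IH => y y_rs k /setD1P[_ kS]; apply: rs_ge0 => //.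
by rewrite in_cons y_rs orbT.
Qed.

Lemma rper_gt0 (R : numDomainType) n (rs : seq 'rV[R]_n)
    (S : {set 'I_n}) :
  (size rs <= #|S|)%N -> (forall x, x \in rs -> posrow S x) -> 0 < rper rs S.
Proof.
elim: rs S => [|x rs IH] S //= szS rs_gt0.
have /card_gt0P[j0 j0S] : (0 < #|S|)%N by apply: leq_trans szS.
have pos j : j \in S -> 0 < x 0 j * rper rs (S :\ j).
  move=> jS; apply: mulr_gt0; first exact/rs_gt0/jS/mem_head.
  apply: IH; first by rewrite (cardsD1 j S) jS in szS.
  move=> y y_rs; apply: posrowS (subD1set S j) _.
  by apply: rs_gt0; rewrite in_cons y_rs orbT.
rewrite (bigD1 j0) //=; apply: ltr_pwDl; first exact: pos.
by apply: sumr_ge0 => j /andP[jS _]; apply/ltW/pos.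
Qed.

(** Unit rows turn minors into values of the multilinear form; the Gram matrix [W] in [rper_AF] is
    built from them. *)
Lemma rper_delta (R : comPzRingType) n l (rs : seq 'rV[R]_n) (S : {set 'I_n}) :
  rper (delta_mx 0 l :: rs) S = (l \in S)%:R * rper rs (S :\ l).
Proof.
rewrite /=; case: (boolP (l \in S)) => lS.
  rewrite (bigD1 l) //= mxE !eqxx big1 ?addr0 // => k /andP[_ kl].
  by rewrite mxE (negPf kl) andbF mul0r.
rewrite mul0r big1 // => k kS; have kl : k != l by apply: contraNneq lS => <-.
by rewrite mxE (negPf kl) andbF mul0r.
Qed.

Lemma rper_cons_delta (R : comPzRingType) n (x : 'rV[R]_n) rs (S : {set 'I_n}) :
  rper (x :: rs) S = \sum_(j in S) x 0 j * rper (delta_mx 0 j :: rs) S.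
Proof. by apply: eq_bigr => j jS; rewrite rper_delta jS mul1r. Qed.

(** * The Alexandrov-Fenchel inequality for permanents *)

(** Let [P] be the diagonal matrix of [p]. The last hypothesis on [W] keeps the eigenvalues of
    [P^-1 W] out of the interval (0, 1), and by Perron-Frobenius the positive eigenvector [a] makes
    1 the simple largest one. So the form of [W] is nonpositive on the [P]-orthogonal complement of
    [a]. The proof replaces spectral theory by solving [(P - W) y = P x]. *)
Lemma lorentz_criterion (R : realFieldType) n (S : {set 'I_n})
    (W : 'I_n -> 'I_n -> R) (a p : 'I_n -> R) :
  (forall j l, W j l = W l j) ->
  (forall j l, j \in S -> l \in S -> j != l -> 0 < W j l) ->
  (forall j, j \in S -> 0 < a j) -> (forall j, j \in S -> 0 < p j) ->
  (forall j, j \in S -> \sum_(l in S) W j l * a l = p j * a j) ->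
  (forall x : 'I_n -> R, \sum_(j in S) x j * (\sum_(l in S) W j l * x l) <=
    \sum_(j in S) (\sum_(l in S) W j l * x l) ^+ 2 / p j) ->
  forall x : 'I_n -> R, \sum_(j in S) p j * a j * x j = 0 ->
  \sum_(j in S) x j * (\sum_(l in S) W j l * x l) <= 0.
Proof.
move=> Wsym Wpos a_gt0 p_gt0 Wa Wsq x x_orth.
pose N (y : 'I_n -> R) j := p j * y j - \sum_(l in S) W j l * y l.
(* [N = P - W] becomes a weighted graph Laplacian in the variables [y j / a j], because [W a = P a];
   hence it is positive semidefinite with kernel spanned by [a]. *)
have N_sos y : 2 * \sum_(j in S) y j * N y j =
    \sum_(j in S) \sum_(l in S) W j l * a j * a l * (y j / a j - y l / a l) ^+ 2.
  pose f j l := W j l * (a l * y j ^+ 2 / a j - y j * y l).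
  have -> : \sum_(j in S) y j * N y j = \sum_(j in S) \sum_(l in S) f j l.
    apply: eq_bigr => j jS.
    have -> : \sum_(l in S) f j l = (\sum_(l in S) W j l * a l) * (y j ^+ 2 / a j)
        - (\sum_(l in S) W j l * y l) * y j.
      rewrite !mulr_suml -sumrB; apply: eq_bigr => l _; rewrite /f; ring.
    rewrite Wa // /N; have := a_gt0 _ jS => aj.
    by field; rewrite gt_eqF.
  rewrite mulr_natl mulr2n {2}exchange_big -big_split /=.
  apply: eq_bigr => j jS; rewrite -big_split /=; apply: eq_bigr => l lS.
  rewrite /f [W l j]Wsym; have aj := a_gt0 _ jS; have al := a_gt0 _ lS.
  by field; rewrite !gt_eqF.
have N_term y j l : j \in S -> l \in S ->
    0 <= W j l * a j * a l * (y j / a j - y l / a l) ^+ 2.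
  move=> jS lS; have [->|jl] := eqVneq j l; first by rewrite subrr expr0n mulr0.
  rewrite mulr_ge0 ?sqr_ge0 // ltW // mulr_gt0 ?a_gt0 // mulr_gt0 ?a_gt0 //.
  exact: Wpos.
have N_ge0 y : 0 <= \sum_(j in S) y j * N y j.
  rewrite -(pmulr_rge0 _ (ltr0Sn R 1)) N_sos.
  by apply: sumr_ge0 => j jS; apply: sumr_ge0 => l lS; apply: N_term.
have N_ker y : (forall j, j \in S -> N y j = 0) ->
    forall j l, j \in S -> l \in S -> y j / a j = y l / a l.
  move=> Ny0 j l jS lS; have [->//|jl] := eqVneq j l.
  have /esym := N_sos y.
  rewrite [X in 2 * X]big1 ?mulr0; last by move=> i iS; rewrite Ny0 ?mulr0.
  move=> sum0.
  have row0 := psumr_eq0P (fun i iS =>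
    sumr_ge0 _ (fun k kS => N_term y i k iS kS)) sum0 jS.
  have /eqP := psumr_eq0P (fun i iS => N_term y j i jS iS) row0 lS.
  rewrite mulf_eq0 sqrf_eq0 subr_eq0 => /orP[|/eqP//].
  by rewrite gt_eqF // mulr_gt0 ?a_gt0 // mulr_gt0 ?a_gt0 // Wpos.
have [y Ny] : exists y, forall j, j \in S -> N y j = p j * x j.
  pose M : 'M[R]_n := \matrix_(l, j)
    if (l \in S) && (j \in S) then (j == l)%:R * p j - W j l else 0.
  pose u : 'rV[R]_n := \row_j if j \in S then p j * x j else 0.
  have Me (v : 'I_n -> R) j : j \in S -> \sum_l v l * M l j = N v j.
    move=> jS; rewrite (bigID (fun l => l \in S)) /= [X in _ + X]big1 ?addr0; last first.
      by move=> l lS; rewrite mxE (negPf lS) mulr0.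
    transitivity (\sum_(l in S) ((j == l)%:R * (p j * v l) - W j l * v l)).
      by apply: eq_bigr => l lS; rewrite mxE lS jS /=; ring.
    rewrite sumrB /N; congr (_ - _); rewrite (bigD1 j) //= eqxx mul1r.
    by rewrite big1 ?addr0 // => l /andP[_ lj]; rewrite eq_sym (negPf lj) mul0r.
  (* Fredholm alternative: a vector killed by [M] is proportional to [a] on [S], and [u] annihilates
     it by [x_orth]. *)
  have uM : (u <= M)%MS.
    rewrite submxE; apply/eqP/rowP => k; rewrite [LHS]mxE [RHS]mxE.
    pose c l := cokermx M l k.
    have Nc j : j \in S -> N c j = 0.
      move=> jS; rewrite -Me //.
      have /matrixP/(_ j k) := mulmx_coker M.
      rewrite [LHS]mxE [RHS]mxE; apply: etrans.
      apply: eq_bigr => l _; rewrite mulrC; congr (_ * _).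
      rewrite !mxE jS andbT; case: ifP => lS //=.
      by case: (eqVneq j l) => [->//|_]; rewrite !mul0r !sub0r Wsym.
    rewrite (bigID (fun l => l \in S)) /= [X in _ + X]big1 ?addr0; last first.
      by move=> l lS; rewrite mxE (negPf lS) mul0r.
    have [->|[j0 j0S]] := set_0Vmem S; first by rewrite big1 // => i; rewrite inE.
    transitivity (\sum_(j in S) p j * a j * x j * (c j0 / a j0)).
      apply: eq_bigr => j jS; rewrite mxE jS -(N_ker c Nc j j0) //.
      have aj := a_gt0 _ jS; rewrite -/(c j); field; by rewrite gt_eqF.
    by rewrite -mulr_suml x_orth mul0r.
  have [D uD] := submxP uM; exists (fun l => D 0 l) => j jS.
  rewrite -Me //; have /rowP/(_ j) := uD.
  by rewrite !mxE jS => ->.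
have Nxy : \sum_(j in S) y j * N x j = \sum_(j in S) x j * N y j.
  rewrite /N; under eq_bigr do rewrite mulrBr mulr_sumr.
  under [RHS]eq_bigr do rewrite mulrBr mulr_sumr.
  rewrite !sumrB; congr (_ - _).
    by apply: eq_bigr => j _; rewrite mulrCA [x j * _]mulrCA [y j * _]mulrC.
  rewrite exchange_big /=; apply: eq_bigr => j _; apply: eq_bigr => l _.
  by rewrite Wsym; ring.
have xNy : \sum_(j in S) x j * N y j = \sum_(j in S) p j * x j ^+ 2.
  by apply: eq_bigr => j jS; rewrite Ny //; ring.
have yNy : \sum_(j in S) y j * N y j = \sum_(j in S) p j * x j * y j.
  by apply: eq_bigr => j jS; rewrite Ny //; ring.
have Wy j : j \in S -> \sum_(l in S) W j l * y l = p j * (y j - x j).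
  by move=> jS; have := Ny j jS; rewrite /N => e; rewrite mulrBr -e; ring.
have := Wsq y.
under eq_bigr => j jS do rewrite (Wy j jS).
under [X in _ <= X]eq_bigr => j jS do rewrite (Wy j jS).
have -> : \sum_(j in S) (p j * (y j - x j)) ^+ 2 / p j =
    \sum_(j in S) y j * (p j * (y j - x j))
    - \sum_(j in S) p j * x j * y j + \sum_(j in S) p j * x j ^+ 2.
  rewrite -sumrB -big_split /=; apply: eq_bigr => j jS.
  by have pj := p_gt0 _ jS; field; rewrite gt_eqF.
move=> sq_le.
(* In matrix notation [sq_le] says [y P x <= x P x], while nonnegativity of [N] at [x - y] says
   [x W x <= y P x - x P x]. *)
have := N_ge0 (fun j => x j - y j).
have -> : \sum_(j in S) (x j - y j) * N (fun j => x j - y j) j =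
    \sum_(j in S) x j * N x j - \sum_(j in S) x j * N y j
    - \sum_(j in S) y j * N x j + \sum_(j in S) y j * N y j.
  rewrite -!sumrB -big_split /=; apply: eq_bigr => j _.
  have -> : N (fun j => x j - y j) j = N x j - N y j.
    rewrite /N; under eq_bigr do rewrite mulrBr.
    by rewrite sumrB; ring.
  by ring.
have -> : \sum_(j in S) x j * N x j = \sum_(j in S) p j * x j ^+ 2
    - \sum_(j in S) x j * \sum_(l in S) W j l * x l.
  by rewrite -sumrB; apply: eq_bigr => j _; rewrite /N; ring.
rewrite Nxy xNy yNy; move: sq_le; lra.
Qed.

(** Induction on the number of fixed rows. The inequality for the minors without column [j] yields
    the spectral hypothesis of [lorentz_criterion], so the form [Q] is nonpositive on the orthogonal
    complement of the fixed row [a]; the claim is then a reversed Cauchy-Schwarz inequality. With no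
    fixed rows the difference of the two sides is a square. *)
Lemma rper_AF (R : realFieldType) n (x y : 'rV[R]_n) rs (S : {set 'I_n}) :
  (size rs).+2 = #|S| -> posrow S y -> (forall z, z \in rs -> posrow S z) ->
  rper (x :: x :: rs) S * rper (y :: y :: rs) S <= rper (x :: y :: rs) S ^+ 2.
Proof.
elim: rs S x y => [|a rs IH] S x y szS y_gt0 rs_gt0.
  have /eqP/cards2P[j [l [jl ->]]] : #|S| = 2 by rewrite -szS.
  rewrite /= !(big_setU1, big_set1) ?inE //=.
  have -> : [set j; l] :\ j = [set l].
    by apply/setP => k; rewrite !inE; case: eqVneq => [->|] //=; rewrite (negPf jl).
  have -> : [set j; l] :\ l = [set j].
    apply/setP => k; rewrite !inE.
    case: (eqVneq k l) => [->|]; rewrite ?orbF //=.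
    by rewrite eq_sym (negPf jl).
  rewrite !big_set1 !mulr1.
  have := sqr_ge0 (x 0 j * y 0 l - x 0 l * y 0 j); lra.
have a_gt0 : posrow S a by apply: rs_gt0; rewrite mem_head.
have rs'_gt0 z : z \in rs -> posrow S z.
  by move=> z_rs; apply: rs_gt0; rewrite in_cons z_rs orbT.
pose Q u v := rper (u :: v :: a :: rs) S.
have QC u v : Q u v = Q v u by apply: rper_swap.
have QD u b v w : Q (b *: u + v) w = b * Q u w + Q v w by apply: rper_linear.
have szD j : j \in S -> (size rs).+2 = #|S :\ j|.
  by move=> jS; move: szS; rewrite (cardsD1 j) jS => -[].
have posD j (z : 'rV[R]_n) : j \in S -> posrow S z -> posrow (S :\ j) z.
  by move=> _; apply/posrowS/subD1set.
pose w j u := rper (u :: a :: rs) (S :\ j).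
have Qw u v : Q u v = \sum_(j in S) u 0 j * w j v by [].
have Qdelta j v : j \in S -> Q (delta_mx 0 j) v = w j v.
  by move=> jS; rewrite /Q rper_delta jS mul1r.
have wpos j u : j \in S -> posrow S u -> 0 < w j u.
  move=> jS u_gt0; apply: rper_gt0; first by rewrite -szD.
  by move=> z; rewrite !in_cons => /or3P[/eqP->|/eqP->|/rs'_gt0]; apply: posD.
have Qle0 u : Q u a = 0 -> Q u u <= 0.
  move=> Qua.
  pose W j l := Q (delta_mx 0 j) (delta_mx 0 l).
  have WE j (v : 'rV[R]_n) : j \in S -> \sum_(l in S) W j l * v 0 l = w j v.
    move=> jS; rewrite -Qdelta // QC [RHS]rper_cons_delta.
    by apply: eq_bigr => l _; rewrite /W QC mulrC.
  rewrite Qw; under eq_bigr => j jS do rewrite -WE //.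
  (* [p] is forced by the eigenvector equation: [W] applied to [a] has the [j]-th entry [w j a]. *)
  pose a' j := a 0 j; pose p j := w j a / a 0 j.
  apply: (@lorentz_criterion _ _ S W a' p _ _ _ _ _ _ (fun j => u 0 j)).
  - by move=> j l; apply: QC.
  - move=> j l jS lS jl.
    rewrite /W Qdelta // /w rper_delta in_setD1 eq_sym jl lS mul1r.
    apply: (@rper_gt0 _ _ (a :: rs)).
      have := szD _ jS; rewrite (cardsD1 l (S :\ j)) in_setD1 eq_sym jl lS /= add1n => -[<-].
      exact: leqnn.
    move=> z; rewrite in_cons => /orP[/eqP->|/rs'_gt0 z_gt0]; last first.
      by apply: posrowS z_gt0; rewrite setDDl subsetDl.
    by apply: posrowS a_gt0; rewrite setDDl subsetDl.
  - by move=> j; apply: a_gt0.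
  - by move=> j jS; rewrite divr_gt0 ?wpos ?a_gt0.
  - move=> j jS; rewrite WE // /p /a' divfK // gt_eqF //; exact: a_gt0.
  - move=> v; pose v' : 'rV[R]_n := \row_j v j.
    have vE : v =1 v' 0 by move=> j; rewrite mxE.
    have WvE j : j \in S -> \sum_(l in S) W j l * v l = w j v'.
      by move=> jS; rewrite -WE //; apply: eq_bigr => l _; rewrite vE.
    under eq_bigr => j jS do rewrite WvE // vE.
    under [X in _ <= X]eq_bigr => j jS do rewrite WvE //.
    (* Expanding along [a] instead of [v'] splits the inequality into one instance of the induction
       hypothesis for each deleted column. *)
    rewrite -Qw /Q.
    have -> : rper [:: v', v', a & rs] S = rper [:: a, v', v' & rs] S.
      apply: rper_perm.
      by rewrite -[[:: v', v', a & rs]]/([:: v'; v'] ++ [:: a] ++ rs) perm_catCA.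
    rewrite [X in X <= _]/=; apply: ler_sum => j jS.
    rewrite /p invf_div mulrCA ler_pM2l ?a_gt0 //.
    rewrite ler_pdivlMr ?wpos //.
    apply: (IH (S :\ j) v' a); [exact: szD|exact: posD|].
    by move=> z /rs'_gt0; apply: posD.
  - transitivity (Q u a) => [|//]; rewrite Qw; apply: eq_bigr => j jS.
    rewrite /p /a' divfK ?gt_eqF ?a_gt0 //.
    by rewrite mulrC.
have Qya : 0 < Q y a.
  apply: rper_gt0; first by rewrite -szS.
  by move=> z; rewrite !in_cons => /or4P[/eqP->|/eqP->|/eqP->|/rs'_gt0].
have Qyy : 0 < Q y y.
  apply: rper_gt0; first by rewrite -szS.
  by move=> z; rewrite !in_cons => /or4P[/eqP->|/eqP->|/eqP->|/rs'_gt0].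
(* [c] makes [x - c y] orthogonal to [a]; then [Q u u <= 0] is a quadratic inequality in [c], and
   completing the square eliminates [c]. *)
pose c := Q x a / Q y a; pose u := (- c) *: y + x.
have Qu0 : Q u a = 0 by rewrite QD mulNr /c divfK ?gt_eqF // addNr.
have := Qle0 _ Qu0.
rewrite QD !(QC _ u) !QD (QC x y) -/(Q x x) -/(Q y y) -/(Q x y) => Quu.
have := sqr_ge0 (Q y y * c - Q y x).
rewrite (QC x y) -subr_ge0; move: Quu Qyy; nra.
Qed.

(** * Logarithm estimates and Jensen's inequality *)

Lemma derive_ge0_homo (R : realType) (f df : R -> R) (a b : R) : a <= b ->
  (forall x : R, a <= x <= b -> is_derive x 1 f (df x)) ->
  (forall x, a <= x <= b -> 0 <= df x) -> f a <= f b.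
Proof.
move=> ab fdf df_ge0.
have [x||c] := @MVT_segment R f df a b ab.
- by rewrite in_itv /= => /andP[ax xb]; apply: fdf; rewrite (ltW ax) (ltW xb).
- apply: derivable_within_continuous => y; rewrite in_itv /= => yab.
  by apply: ex_derive; apply: fdf.
- rewrite in_itv /= => cab fab.
  by rewrite -subr_ge0 fab mulr_ge0 ?subr_ge0 //; apply: df_ge0.
Qed.

(** The gap vanishes at 1 and its derivative is a square over a positive quantity;
    [ln_le_hyperbolic] is proved in the same way. *)
Lemma ln_ge_mobius (R : realType) (z : R) : 1 <= z -> 2 * (z - 1) / (z + 1) <= ln z.
Proof.
move=> z1.
have := @derive_ge0_homo R (fun x => ln x + 4 * (x + 1)^-1)
  (fun x => x^-1 + 4 * (- (x + 1) ^- 2 * 1)) 1 z z1.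
have -> : 2 * (z - 1) / (z + 1) = 2 - 4 * (z + 1)^-1.
  by field; rewrite gt_eqF //; lra.
rewrite ln1 add0r; have -> : 4 * (1 + 1)^-1 = 2 :> R by field.
move=> H; rewrite lerBlDr; apply: H => // x /andP[x1 xz]; have x0 : 0 < x by lra.
  apply: is_deriveD; first exact: is_derive1_ln.
  apply: is_deriveZ.
  have := @is_deriveV R (fun y => y + 1) x 1 1.
  rewrite /GRing.scale /=; apply; first by rewrite gt_eqF //; lra.
  by rewrite -[X in is_derive _ _ _ X]addr0; apply: is_deriveD.
have -> : x^-1 + 4 * (- (x + 1) ^- 2 * 1) = (x - 1) ^+ 2 / (x * (x + 1) ^+ 2).
  by field; rewrite !gt_eqF //; lra.
by rewrite divr_ge0 ?sqr_ge0 // mulr_ge0 ?sqr_ge0 //; lra.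
Qed.

Lemma ln_le_hyperbolic (R : realType) (z : R) : 1 <= z -> ln z <= (z - z^-1) / 2.
Proof.
move=> z1.
have := @derive_ge0_homo R (fun x => 2^-1 * x + (- 2^-1) * x^-1 - ln x)
  (fun x => 2^-1 * 1 + (- 2^-1) * (- x ^- 2 * 1) - x^-1) 1 z z1.
have -> : 2^-1 * 1 + - 2^-1 * 1^-1 - ln 1 = 0 :> R by rewrite ln1; field.
move=> H; rewrite -subr_ge0.
have -> : (z - z^-1) / 2 - ln z = 2^-1 * z + - 2^-1 / z - ln z.
  by field; rewrite gt_eqF //; lra.
apply: H => x /andP[x1 xz]; have x0 : 0 < x by lra.
  apply: is_deriveB; last exact: is_derive1_ln.
  apply: is_deriveD.
  apply: is_deriveZ.
  have := @is_deriveV R id x 1 1.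
  by rewrite /GRing.scale /=; apply; rewrite gt_eqF.
have -> : 2^-1 * 1 + - 2^-1 * (- x ^- 2 * 1) - x^-1 = (x - 1) ^+ 2 / (2 * x ^+ 2).
  by field; rewrite gt_eqF.
by rewrite divr_ge0 ?sqr_ge0 // mulr_ge0 ?sqr_ge0 //; lra.
Qed.

(** Second-order bound at 1 whose quadratic coefficient is uniform for [z <= w]. For [z >= 1] the
    Moebius bound gives the coefficient [1 / (z + 1)]; for [z <= 1] the hyperbolic bound at [z^-1]
    gives [1 / 2]. Both are at least [1 / (w + 1)]. *)
Lemma xlnx_ge (R : realType) (w z : R) : 0 < z -> z <= w -> 1 <= w ->
  (z - 1) + (z - 1) ^+ 2 / (w + 1) <= z * ln z.
Proof.
move=> z0 zw w1; have [z1|/ltW z1] := leP 1 z.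
  apply: le_trans (_ : z * (2 * (z - 1) / (z + 1)) <= _); last first.
    by rewrite ler_pM2l // ln_ge_mobius.
  have -> : z * (2 * (z - 1) / (z + 1)) = (z - 1) + (z - 1) ^+ 2 / (z + 1).
    by field; rewrite gt_eqF //; lra.
  rewrite lerD2l ler_wpM2l ?sqr_ge0 // lef_pV2 ?posrE; lra.
have := @ln_le_hyperbolic R z^-1; rewrite invf_ge1 // => /(_ z1).
rewrite lnV // invrK => H.
have {H} : (z - z^-1) / 2 <= ln z by lra.
rewrite -(ler_pM2l z0); apply: le_trans.
have -> : z * ((z - z^-1) / 2) = (z - 1) + (z - 1) ^+ 2 / 2.
  by field; rewrite gt_eqF.
rewrite lerD2l ler_wpM2l ?sqr_ge0 // lef_pV2 ?posrE; lra.
Qed.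

(** The tangent of [ln] at the weighted mean [V / W] lies above [ln], and its linear part cancels on
    summation. The weights keep their own total [W], which is [1 - b_l] when the lemma is applied to
    a column. *)
Lemma ln_jensen (R : realType) I (r : seq I) (P : pred I) (w y : I -> R) :
  (forall i, P i -> 0 <= w i) -> (forall i, P i -> 0 < y i) ->
  0 < \sum_(i <- r | P i) w i -> 0 < \sum_(i <- r | P i) w i * y i ->
  \sum_(i <- r | P i) w i * ln (y i) <= (\sum_(i <- r | P i) w i) *
    ln ((\sum_(i <- r | P i) w i * y i) / \sum_(i <- r | P i) w i).
Proof.
move=> w_ge0 y_gt0; set W := \sum_(i <- r | P i) w i => W_gt0.
set V := \sum_(i <- r | P i) w i * y i => V_gt0.
have term i : P i -> w i * ln (y i) <= w i * (y i * (W / V) - 1 + ln (V / W)).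
  move=> Pi; apply: ler_wpM2l; first exact: w_ge0.
  have y0 := y_gt0 _ Pi; have WV : 0 < W / V by rewrite divr_gt0.
  have := @le_ln1Dx R (y i * (W / V) - 1).
  rewrite addrCA subrr addr0 lnM ?posrE //.
  have -> : V / W = (W / V)^-1 by rewrite invf_div.
  rewrite (lnV WV) => H.
  have {H} : ln (y i) + ln (W / V) <= y i * (W / V) - 1.
    by apply: H; rewrite ltrBrDr addNr mulr_gt0.
  by lra.
apply: le_trans (ler_sum _ term) _.
rewrite (eq_bigr (fun i => w i * y i * (W / V) - w i + w i * ln (V / W)));
  last by move=> i _; ring.
rewrite big_split sumrB /= -!mulr_suml -/W -/V.
by rewrite mulrCA divff ?gt_eqF // mulr1 subrr add0r.
Qed.

(** * Gurvits' capacity argument *)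

Lemma rper_mid (R : comPzRingType) n (x : 'rV[R]_n) us vs S :
  rper (us ++ x :: vs) S = rper (x :: us ++ vs) S.
Proof. by apply: rper_perm; rewrite -cat1s perm_catCA. Qed.

(* The coefficients [c_j] of the expansion in powers of [s] are, up to binomials,
   log-concave by [rper_AF], so the progression [c_0 (c_1 / c_0) ^ j] dominates them. *)
Lemma rper_nseq_le (R : realFieldType) n (u v : 'rV[R]_n) s k rs (S : {set 'I_n}) :
  (k.+1 + size rs)%N = #|S| -> posrow S u -> posrow S v ->
  (forall z, z \in rs -> posrow S z) -> 0 <= s ->
  rper (nseq k.+1 (s *: u + v) ++ rs) S <=
  rper (nseq k.+1 v ++ rs) S *
    (1 + s * (rper (u :: nseq k v ++ rs) S / rper (nseq k.+1 v ++ rs) S)) ^+ k.+1.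
Proof.
move=> szS u_gt0 v_gt0 + s_ge0.
have gt0 ws : (size ws = #|S|)%N -> (forall z, z \in ws -> posrow S z) -> 0 < rper ws S.
  by move=> sz ws_gt0; apply: rper_gt0 => //; rewrite sz.
elim: k rs szS => [|k IH] rs szS rs_gt0.
  have c0 : 0 < rper (v :: rs) S.
    apply: gt0 => // z; rewrite in_cons => /orP[/eqP->|] //; exact: rs_gt0.
  rewrite expr1 /nseq /cat rper_linear; move: c0.
  set c0 := rper (v :: rs) S; set c1 := rper (u :: rs) S => c0_gt0.
  by rewrite le_eqVlt; apply/orP; left; apply/eqP; field; rewrite gt_eqF.
have szv : (k.+1 + size (v :: rs))%N = #|S| by rewrite -szS /= addnS.
have szu : (k.+1 + size (u :: rs))%N = #|S| by rewrite -szS /= addnS.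
have v_rs z : z \in v :: rs -> posrow S z.
  by rewrite in_cons => /orP[/eqP->|/rs_gt0].
have u_rs z : z \in u :: rs -> posrow S z.
  by rewrite in_cons => /orP[/eqP->|/rs_gt0].
have e0 : rper (nseq k.+1 v ++ v :: rs) S = rper (nseq k.+2 v ++ rs) S.
  exact: rper_mid.
have e1 : rper (u :: nseq k v ++ v :: rs) S = rper (u :: nseq k.+1 v ++ rs) S.
  by rewrite -cat_cons rper_mid [RHS]rper_swap.
have e1' : rper (nseq k.+1 v ++ u :: rs) S = rper (u :: nseq k.+1 v ++ rs) S.
  exact: rper_mid.
have e2 : rper (u :: nseq k v ++ u :: rs) S = rper (u :: u :: nseq k v ++ rs) S.
  by rewrite -cat_cons rper_mid.
(* One row [s *: u + v] is split by linearity; the induction hypothesis is used with [u],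
   respectively [v], added to the fixed rows. *)
have := IH _ szv v_rs; have := IH _ szu u_rs; rewrite e0 e1 e1' e2.
have -> : rper (nseq k.+2 (s *: u + v) ++ rs) S =
    s * rper (nseq k.+1 (s *: u + v) ++ u :: rs) S
    + rper (nseq k.+1 (s *: u + v) ++ v :: rs) S.
  by rewrite [nseq k.+2 _]/= cat_cons rper_linear !rper_mid.
have nseq_gt0 z : z \in nseq k v ++ rs -> posrow S z.
  by rewrite mem_cat => /orP[/nseqP[-> _]|/rs_gt0].
have A0 : 0 < rper (nseq k.+2 v ++ rs) S.
  apply: gt0 => [|z]; first by rewrite size_cat size_nseq.
  by rewrite /= !in_cons => /or3P[/eqP->|/eqP->|/nseq_gt0].
have A1 : 0 < rper (u :: nseq k.+1 v ++ rs) S.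
  apply: gt0 => [|z]; first by rewrite -szS /= size_cat size_nseq.
  by rewrite /= !in_cons => /or3P[/eqP->|/eqP->|/nseq_gt0].
have A2 : 0 <= rper (u :: u :: nseq k v ++ rs) S.
  apply: rper_ge0 => z; rewrite !in_cons => /or3P[/eqP->|/eqP->|/nseq_gt0 z_gt0] j jS;
    [exact/ltW/u_gt0|exact/ltW/u_gt0|exact/ltW/z_gt0].
have := @rper_AF _ _ u v (nseq k v ++ rs) S.
rewrite size_cat size_nseq -szS => /(_ erefl v_gt0 nseq_gt0).
rewrite -[v :: v :: _]/(nseq k.+2 v ++ rs) -[v :: nseq k v ++ rs]/(nseq k.+1 v ++ rs).
move: A0 A1 A2; set a0 := rper (nseq k.+2 v ++ rs) S.
set a1 := rper (u :: nseq k.+1 v ++ rs) S; set a2 := rper (u :: u :: _) S.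
move=> a0_gt0 a1_gt0 a2_ge0 AF le_u le_v.
(* Alexandrov-Fenchel in quotient form: the ratio with [u] among the fixed rows is at most the ratio
   with [v], so both estimates share one power. *)
have rho : a2 / a1 <= a1 / a0 by rewrite ler_pdivrMr // mulrAC ler_pdivlMr // -expr2.
have base : 0 <= 1 + s * (a2 / a1).
  by rewrite addr_ge0 // mulr_ge0 // divr_ge0 // ltW.
have pow : (1 + s * (a2 / a1)) ^+ k.+1 <= (1 + s * (a1 / a0)) ^+ k.+1.
  by apply: lerXn2r;
    rewrite ?nnegrE ?lerD2l ?ler_wpM2l // (le_trans base) // lerD2l ler_wpM2l.
apply: le_trans (lerD (ler_wpM2l s_ge0
  (le_trans le_u (ler_wpM2l (ltW a1_gt0) pow))) le_v) _.
rewrite le_eqVlt; apply/orP; left; apply/eqP; rewrite [in RHS]exprS.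
by move: (_ ^+ k.+1) => X; field; rewrite gt_eqF.
Qed.

(* Gurvits' capacity argument: each step optimizes the multiplier of one row. *)
Lemma capacity_le (R : realFieldType) n (I : eqType) (a : I -> 'rV[R]_n)
    (S : {set 'I_n}) (s : seq I) rs (C : R) :
  uniq s -> (size s + size rs)%N = #|S| ->
  (forall i, i \in s -> posrow S (a i)) -> (forall z, z \in rs -> posrow S z) ->
  (forall t : I -> R, (forall i, 0 < t i) -> C * \prod_(i <- s) t i <=
     rper (nseq (size s) (\sum_(i <- s) t i *: a i) ++ rs) S) ->
  C <= (size s)%:R ^+ size s * rper (map a s ++ rs) S.
Proof.
elim: s rs C => [|h s IH] rs C.
  by move=> _ _ _ _ /(_ (fun=> 1) (fun=> ltr01)); rewrite big_nil mulr1 mul1r.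
move=> /andP[hs us] szS a_gt0 rs_gt0 capC.
have ah_gt0 : posrow S (a h) by apply: a_gt0; rewrite mem_head.
have as_gt0 i : i \in s -> posrow S (a i).
  by move=> is_; apply: a_gt0; rewrite in_cons is_ orbT.
have szS' : (size s + size (a h :: rs))%N = #|S| by rewrite -szS /= addnS addSn.
have ahrs_gt0 z : z \in a h :: rs -> posrow S z.
  by rewrite in_cons => /orP[/eqP->|/rs_gt0].
(* If [h] is the only row left, then [k = 0] and the optimal multiplier below would be infinite; the
   hypothesis at the multiplier 1 is already the claim. *)
have [s0|s_gt0] := posnP (size s).
  have := capC (fun=> 1) (fun=> ltr01); move/size0nil: s0 => ->.
  by rewrite /= !big_seq1 mulr1 expr1n mul1r scale1r.
set k := size s in s_gt0 szS'.
have kR : 0 < k%:R :> R by rewrite ltr0n.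
have k1R : 0 < k.+1%:R :> R by rewrite ltr0n.
have kE : k.+1%:R = k%:R + 1 :> R by rewrite -natr1.
(* The loss in eliminating one multiplier; over the induction these factors telescope to
   [(size s) ^- size s]. *)
pose c := (k%:R ^+ k / k.+1%:R ^+ k.+1 : R).
have c_gt0 : 0 < c by rewrite divr_gt0 // exprn_gt0.
have step t : (forall i, 0 < t i) -> C * c * \prod_(i <- s) t i <=
    rper (nseq k (\sum_(i <- s) t i *: a i) ++ a h :: rs) S.
  move=> t_gt0; set v := \sum_(i <- s) t i *: a i.
  have v_gt0 : posrow S v.
    move=> j jS; rewrite summxE big_seq.
    have v_ge0 i : i \in s -> 0 < (t i *: a i) 0 j.
      by move=> is_; rewrite mxE mulr_gt0 //; apply: as_gt0.
    move: s_gt0; rewrite /k; case: (s) v_ge0 => // i0 s0 v_ge0 _.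
    rewrite -big_seq big_cons; apply: ltr_pwDl; first by rewrite v_ge0 ?mem_head.
    rewrite big_seq; apply: sumr_ge0 => i is0.
    by apply/ltW/v_ge0; rewrite in_cons is0 orbT.
  have c0_gt0 : 0 < rper (nseq k.+1 v ++ rs) S.
    apply: rper_gt0; first by rewrite size_cat size_nseq -szS.
    by move=> z; rewrite mem_cat => /orP[/nseqP[-> _]|/rs_gt0].
  have c1_gt0 : 0 < rper (a h :: nseq k v ++ rs) S.
    apply: rper_gt0; first by rewrite /= size_cat size_nseq -szS.
    move=> z; rewrite in_cons mem_cat.
    by move=> /or3P[/eqP->|/nseqP[-> _]|/rs_gt0].
  rewrite rper_mid.
  (* The multiplier [q = c0 / (c1 * k)] minimizes [c0 * (1 + q * (c1 / c0)) ^+ k.+1 / q]. *)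
  have := @rper_nseq_le _ _ (a h) v
    (rper (nseq k.+1 v ++ rs) S / (rper (a h :: nseq k v ++ rs) S * k%:R))
    k rs S szS ah_gt0 v_gt0 rs_gt0.
  move: c0_gt0 c1_gt0; set c0 := rper (nseq k.+1 v ++ rs) S.
  set c1 := rper (a h :: nseq k v ++ rs) S => c0_gt0 c1_gt0.
  set q := c0 / (c1 * k%:R); have q_gt0 : 0 < q by rewrite divr_gt0 ?mulr_gt0.
  move=> /(_ (ltW q_gt0)).
  have t'_gt0 i : 0 < if i == h then q else t i by case: ifP.
  have := capC _ t'_gt0.
  have tE i : i \in s -> (if i == h then q else t i) = t i.
    by move=> is_; case: eqP is_ hs => // -> ->.
  rewrite !big_cons eqxx.
  rewrite [\prod_(_ <- _) _]big_seq (eq_bigr t) => [|i is_]; last exact: tE.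
  rewrite -big_seq [\sum_(_ <- _) _]big_seq.
  rewrite (eq_bigr (fun i => t i *: a i)) => [|i is_]; last by rewrite tE.
  rewrite -big_seq -/v [size _]/= -/k.
  have -> : 1 + q * (c1 / c0) = k.+1%:R / k%:R.
    by rewrite /q kE; field; rewrite !gt_eqF.
  move=> le1 le2; have := le_trans le1 le2.
  rewrite expr_div_n mulrCA -(ler_pM2l (_ : 0 < c / q)); last by rewrite divr_gt0.
  have -> : c / q * (q * (C * \prod_(j <- s) t j)) = C * c * \prod_(j <- s) t j.
    by field; rewrite gt_eqF.
  have -> : c / q * (c0 * (k.+1%:R ^+ k.+1 / k%:R ^+ k.+1)) = c1 => //.
  rewrite /c /q [k%:R ^+ k.+1]exprS; field.
  by rewrite !gt_eqF ?exprn_gt0.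
have := IH (a h :: rs) (C * c) us szS' as_gt0 ahrs_gt0 step.
rewrite rper_mid -/k -cat_cons -map_cons [size (h :: s)]/= -/k /c.
rewrite mulrA ler_pdivrMr ?exprn_gt0 // mulrC -mulrA ler_pM2l ?exprn_gt0 //.
by rewrite mulrC.
Qed.

(** * A van der Waerden bound with a quadratic excess *)

Lemma rper_nseq (R : comPzRingType) n (v : 'rV[R]_n) (S : {set 'I_n}) :
  rper (nseq #|S| v) S = (#|S|)`!%:R * \prod_(l in S) v 0 l.
Proof.
move Dm : #|S| => m; elim: m S Dm => [|m IH] S Dm.
  by move/cards0_eq: Dm => ->; rewrite /= big_set0 mulr1.
rewrite -[LHS]/(\sum_(j in S) v 0 j * rper (nseq m v) (S :\ j)).
transitivity (\sum_(j in S) m`!%:R * \prod_(l in S) v 0 l).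
  apply: eq_bigr => j jS; rewrite IH; last by move: Dm; rewrite (cardsD1 j) jS => -[].
  by rewrite mulrCA (big_setD1 j jS).
by rewrite sumr_const Dm factS natrM -[LHS]mulr_natl mulrA.
Qed.

Lemma ln_prod (R : realType) I (r : seq I) (P : pred I) (f : I -> R) :
  (forall i, P i -> 0 < f i) ->
  ln (\prod_(i <- r | P i) f i) = \sum_(i <- r | P i) ln (f i).
Proof.
move=> f_gt0; rewrite -[RHS]expRK expR_sum; congr ln.
by apply: eq_bigr => i Pi; rewrite lnK // posrE f_gt0.
Qed.

Definition row_stochastic (R : numDomainType) n (S : {set 'I_n}) (x : 'rV[R]_n) : Prop :=
  \sum_(j in S) x 0 j = 1.

(** The mean of [1 - b_l] is [th = (N - 1) / N]. Apply [xlnx_ge] to [(1 - b_l) / th], which is at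
    most [th^-1]: the linear terms sum to zero over the row, and [1 + x <= exp x] turns the
    quadratic sum into the stated factor. *)
Lemma row_entropy_bound (R : realType) n (b : 'rV[R]_n) (S : {set 'I_n}) :
  (1 < #|S|)%N -> posrow S b -> (forall l, l \in S -> b 0 l < 1) ->
  row_stochastic S b ->
  ((#|S|%:R - 1) / #|S|%:R) ^+ #|S|.-1 *
    (1 + #|S|%:R / (2 * #|S|%:R - 1) * \sum_(j in S) (b 0 j - #|S|%:R^-1) ^+ 2)
  <= expR (\sum_(l in S) (1 - b 0 l) * ln (1 - b 0 l)).
Proof.
move=> cS b_gt0 b_lt1 b_sum; set N := #|S| in cS *; set x : R := N%:R.
have x1 : 1 < x by rewrite ltr1n.
pose th := (x - 1) / x; have th_gt0 : 0 < th by rewrite divr_gt0; lra.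
have term l : l \in S -> (1 - b 0 l) * ln th - (b 0 l - x^-1)
    + x / (2 * x - 1) * (b 0 l - x^-1) ^+ 2 <= (1 - b 0 l) * ln (1 - b 0 l).
  move=> lS; have b0 := b_gt0 l lS; have b1 := b_lt1 l lS.
  have z_gt0 : 0 < (1 - b 0 l) / th by rewrite divr_gt0 //; lra.
  have := @xlnx_ge R th^-1 ((1 - b 0 l) / th) z_gt0.
  have -> : (1 - b 0 l) / th <= th^-1.
    by rewrite ler_pdivrMr // mulVf ?gt_eqF //; lra.
  have -> : 1 <= th^-1.
    by rewrite invf_ge1 // /th ler_pdivrMr; lra.
  move=> /(_ isT isT); rewrite -(ler_pM2l th_gt0).
  have -> : th * ((1 - b 0 l) / th * ln ((1 - b 0 l) / th)) =
     (1 - b 0 l) * ln (1 - b 0 l) - (1 - b 0 l) * ln th.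
    rewrite ln_div ?posrE //; last by lra.
    by rewrite mulrA mulrCA mulfV ?gt_eqF // mulr1 mulrBr.
  have -> : th * ((1 - b 0 l) / th - 1 + ((1 - b 0 l) / th - 1) ^+ 2 / (th^-1 + 1)) =
     - (b 0 l - x^-1) + x / (2 * x - 1) * (b 0 l - x^-1) ^+ 2.
    rewrite /th; field; rewrite !gt_eqF //; lra.
  lra.
have cst_sum (c : R) : \sum_(l in S) c = x * c by rewrite sumr_const -[LHS]mulr_natl.
have sum1 : \sum_(l in S) (1 - b 0 l) = x - 1 by rewrite sumrB b_sum cst_sum mulr1.
have sum0 : \sum_(l in S) (b 0 l - x^-1) = 0.
  by rewrite sumrB b_sum cst_sum mulfV ?subrr // gt_eqF //; lra.
have := ler_sum (index_enum 'I_n) term; rewrite big_split sumrB /= -mulr_suml -mulr_sumr.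
rewrite sum1 sum0 subr0 => le_ent.
apply: le_trans (_ : expR ((x - 1) * ln th) * expR (x / (2 * x - 1) *
  \sum_(j in S) (b 0 j - x^-1) ^+ 2) <= _); last by rewrite -expRD ler_expR.
have -> : expR ((x - 1) * ln th) = th ^+ N.-1.
  have -> : x - 1 = N.-1%:R by rewrite -subn1 natrB // ltnW.
  by rewrite expRM_natl lnK.
by rewrite ler_wpM2l ?expR_ge1Dx // exprn_ge0 // ltW.
Qed.

(** The row [b = a k] stays fixed while the multipliers of the other rows are optimized. Two
    applications of Jensen's inequality bound the capacity below by [(size s)! * exp H], and
    [row_entropy_bound] estimates [exp H]. *)
Lemma rper_row_ge (R : realType) n (I : eqType) (a : I -> 'rV[R]_n)
    (S : {set 'I_n}) (k : I) (s : seq I) :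
  uniq (k :: s) -> (size s).+1 = #|S| -> (1 < #|S|)%N ->
  (forall i, i \in k :: s -> posrow S (a i)) ->
  (forall i, i \in k :: s -> row_stochastic S (a i)) ->
  (forall j, j \in S -> \sum_(i <- k :: s) a i 0 j = 1) ->
  (#|S|)`!%:R / #|S|%:R ^+ #|S| *
    (1 + #|S|%:R / (2 * #|S|%:R - 1) * \sum_(j in S) (a k 0 j - #|S|%:R^-1) ^+ 2)
  <= rper (map a (k :: s)) S.
Proof.
move=> /andP[ks us] szS cS a_gt0 a_row a_col; set b := a k.
have b_gt0 : posrow S b by apply: a_gt0; rewrite mem_head.
have b_row : row_stochastic S b by apply: a_row; rewrite mem_head.
have as_gt0 i : i \in s -> posrow S (a i).
  by move=> is_; apply: a_gt0; rewrite in_cons is_ orbT.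
have as_row i : i \in s -> row_stochastic S (a i).
  by move=> is_; apply: a_row; rewrite in_cons is_ orbT.
have as_col j : j \in S -> \sum_(i <- s | i \in s) a i 0 j = 1 - b 0 j.
  by move=> /a_col; rewrite -big_seq big_cons => <-; rewrite addrAC subrr add0r.
have comb_gt0 (t : I -> R) j : (forall i, 0 < t i) -> j \in S ->
    0 < \sum_(i <- s | i \in s) a i 0 j * t i.
  move=> t_gt0 jS.
  have v_gt0 i : i \in s -> 0 < a i 0 j * t i.
    by move=> is_; rewrite mulr_gt0 //; apply: as_gt0.
  move: szS cS; case: (s) v_gt0 => [_ <- //|i0 s0 v_gt0 _ _].
  rewrite -big_seq big_cons; apply: ltr_pwDl; first by rewrite v_gt0 ?mem_head.
  rewrite big_seq; apply: sumr_ge0 => i is0.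
  by apply/ltW/v_gt0; rewrite in_cons is0 orbT.
have b_lt1 l : l \in S -> b 0 l < 1.
  move=> lS; rewrite -subr_gt0 -as_col //.
  have := @comb_gt0 (fun=> 1) l (fun=> ltr01) lS.
  by under eq_bigr do rewrite mulr1.
pose H := \sum_(l in S) (1 - b 0 l) * ln (1 - b 0 l).
have cap (t : I -> R) : (forall i, 0 < t i) -> (size s)`!%:R * expR H * \prod_(i <- s) t i <=
    rper (nseq (size s) (\sum_(i <- s) t i *: a i) ++ [:: b]) S.
  move=> t_gt0; rewrite rper_mid cats0; set v := \sum_(i <- s) _.
  have vE l : v 0 l = \sum_(i <- s | i \in s) a i 0 l * t i.
    rewrite /v summxE [LHS]big_seq; apply: eq_bigr => i _; by rewrite mxE mulrC.
  have v_gt0 l : l \in S -> 0 < v 0 l by move=> lS; rewrite vE; apply: comb_gt0.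
  have -> : rper (b :: nseq (size s) v) S =
      (size s)`!%:R * \sum_(j in S) b 0 j * \prod_(l in S :\ j) v 0 l.
    rewrite -[LHS]/(\sum_(j in S) b 0 j * rper (nseq (size s) v) (S :\ j)) mulr_sumr.
    apply: eq_bigr => j jS; have -> : size s = #|S :\ j|.
      by move: szS; rewrite (cardsD1 j S) jS => -[].
    by rewrite rper_nseq mulrCA.
  rewrite -mulrA ler_pM2l ?ltr0n ?fact_gt0 //.
  have prodv j : 0 < \prod_(l in S :\ j) v 0 l.
    by apply: prodr_gt0 => l /setD1P[_]; apply: v_gt0.
  have sum_gt0 : 0 < \sum_(j in S) b 0 j * \prod_(l in S :\ j) v 0 l.
    have /card_gt0P[j0 j0S] : (0 < #|S|)%N by apply: ltnW.
    rewrite (bigD1 j0) //=; apply: ltr_pwDl; first by rewrite mulr_gt0 ?b_gt0.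
    by apply: sumr_ge0 => j /andP[jS _]; rewrite mulr_ge0 ?ltW ?b_gt0.
  have b_row1 : \sum_(j in S) b 0 j = 1 by [].
  (* Outer Jensen: the entries of [b] are probability weights on the products that omit one
     column. *)
  have := @ln_jensen R _ (index_enum 'I_n) (fun j => j \in S) (b 0)
    (fun j => \prod_(l in S :\ j) v 0 l) (fun j jS => ltW (b_gt0 j jS))
    (fun j _ => prodv j).
  rewrite b_row1 => /(_ ltr01 sum_gt0); rewrite mul1r divr1 /=.
  under eq_bigr => j jS.
    rewrite ln_prod; last by move=> l /setD1P[_]; apply: v_gt0.
    rewrite [X in b 0 j * X](_ : _ = \sum_(l in S) ln (v 0 l) - ln (v 0 j)); last first.
      by rewrite (big_setD1 j jS) /= [RHS]addrC addKr.
    rewrite mulrBr; over.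
  rewrite sumrB -mulr_suml b_row1 mul1r -sumrB => outer.
  (* Inner Jensen in column [l], where the remaining entries have total [1 - b_l]; normalizing by
     this total produces the entropy term. *)
  have inner l : l \in S ->
      \sum_(i <- s) a i 0 l * ln (t i) + (1 - b 0 l) * ln (1 - b 0 l) <=
      ln (v 0 l) - b 0 l * ln (v 0 l).
    move=> lS; have b1 : 0 < 1 - b 0 l by rewrite subr_gt0 b_lt1.
    have := @ln_jensen R _ s (fun i => i \in s) (fun i => a i 0 l) t
      (fun i is_ => ltW (as_gt0 i is_ l lS)) (fun i _ => t_gt0 i).
    rewrite as_col // => /(_ b1 (comb_gt0 t l t_gt0 lS)).
    rewrite -vE -big_seq ln_div ?posrE ?v_gt0 //.
    rewrite [X in _ <= X]mulrBr [X in _ <= X - _]mulrBl mul1r; lra.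
  have prodt_gt0 : 0 < \prod_(i <- s) t i by apply: prodr_gt0.
  rewrite -[X in _ <= X]lnK ?posrE // -[X in _ * X <= _]lnK ?posrE //.
  rewrite -expRD ler_expR; apply: le_trans outer.
  apply: le_trans (ler_sum (index_enum 'I_n) inner).
  rewrite big_split -[X in _ <= _ + X]/H [X in _ <= X]addrC lerD2l.
  (* Since the remaining rows sum to 1, summing over the columns leaves exactly the sum of the
     [ln (t i)]. *)
  rewrite ln_prod // exchange_big /= big_seq.
  rewrite [X in _ <= X]big_seq le_eqVlt; apply/orP; left; apply/eqP.
  apply: eq_bigr => i is_; rewrite -mulr_suml (as_row i is_) mul1r //.
have b_gt0' z : z \in [:: b] -> posrow S z by rewrite mem_seq1 => /eqP->.
have szb : (size s + size [:: b])%N = #|S| by rewrite addn1.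
have := capacity_le us szb as_gt0 b_gt0' cap; rewrite rper_mid cats0.
move=> le_per; have ent := row_entropy_bound cS b_gt0 b_lt1 b_row.
have m_gt0 : 0 < (size s)%:R :> R by rewrite ltr0n -ltnS szS.
rewrite -(ler_pM2l (exprn_gt0 (size s) m_gt0)); apply: le_trans le_per.
apply: le_trans (ler_wpM2l (ler0n _ _) ent).
rewrite -szS /= factS -natr1 addrK natrM -natr1.
set X := 1 + _ * _; rewrite le_eqVlt; apply/orP; left; apply/eqP.
have m1 : (size s)%:R + 1 != 0 :> R by rewrite gt_eqF // ltr_wpDl.
rewrite expr_div_n exprS; field.
by rewrite m1 expf_neq0.
Qed.

(** Every row can serve as the distinguished one; averaging the [N] bounds replaces [N / (2 N - 1)]
    by [1 / (2 N - 1)] in front of the total squared deviation. *)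
Lemma rper_stochastic_gt0_ge (R : realType) n (I : eqType) (a : I -> 'rV[R]_n)
    (S : {set 'I_n}) (s : seq I) :
  uniq s -> size s = #|S| -> (1 < #|S|)%N ->
  (forall i, i \in s -> posrow S (a i)) ->
  (forall i, i \in s -> row_stochastic S (a i)) ->
  (forall j, j \in S -> \sum_(i <- s) a i 0 j = 1) ->
  (#|S|)`!%:R / #|S|%:R ^+ #|S| * (1 + (2 * #|S|%:R - 1)^-1 *
     \sum_(i <- s) \sum_(j in S) (a i 0 j - #|S|%:R^-1) ^+ 2)
  <= rper (map a s) S.
Proof.
move=> us szS cS a_gt0 a_row a_col; set N := #|S| in szS cS *.
set m : R := N`!%:R / _; set c := (2 * _ - 1)^-1.
pose d i := \sum_(j in S) (a i 0 j - N%:R^-1) ^+ 2.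
have N_gt0 : 0 < N%:R :> R by rewrite ltr0n ltnW.
have row_le k : k \in s -> m * (1 + N%:R * c * d k) <= rper (map a s) S.
  move=> ks; have eq_s := perm_to_rem ks.
  rewrite (rper_perm S (perm_map a eq_s)); apply: rper_row_ge => //.
  - by rewrite -(perm_uniq eq_s).
  - by rewrite size_rem // szS prednK // ltnW.
  - by move=> i; rewrite -(perm_mem eq_s); apply: a_gt0.
  - by move=> i; rewrite -(perm_mem eq_s); apply: a_row.
  - by move=> j jS; rewrite -(perm_big _ eq_s) a_col.
have cst_sum (x : R) : \sum_(i <- s) x = N%:R * x.
  by rewrite big_const_seq count_predT szS iter_addr_0 -[LHS]mulr_natl.
have := ler_sum s row_le; rewrite -!big_seq cst_sum -mulr_sumr big_split /=.
rewrite cst_sum -mulr_sumr -/(\sum_(i <- s) d i) => le_sum.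
rewrite -(ler_pM2l N_gt0); apply: le_trans le_sum.
by rewrite le_eqVlt; apply/orP; left; apply/eqP; rewrite /d; ring.
Qed.

(** * Segments of matrices as polynomials, and passage to the boundary *)

(** The moving row [u + t w] as a polynomial in [t], so that permanents along a segment are
    polynomials, with formal derivative and continuity at hand. *)
Definition line_row (R : comNzRingType) n (u w : 'rV[R]_n) : 'rV[{poly R}]_n :=
  map_mx polyC u + 'X *: map_mx polyC w.

Lemma rper_line_horner (R : comNzRingType) n I (u w : I -> 'rV[R]_n) s
    (S : {set 'I_n}) t :
  (rper [seq line_row (u i) (w i) | i <- s] S).[t] =
  rper [seq u i + t *: w i | i <- s] S.
Proof.
rewrite -horner_evalE rper_map -map_comp; apply: rper_eq_in => i j _.
by rewrite !mxE /= /horner_eval !hornerE.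
Qed.

Lemma horner0_ge0 (R : rcfType) (p : {poly R}) :
  (forall t, 0 < t < 1 -> 0 <= p.[t]) -> 0 <= p.[0].
Proof.
move=> p_ge0; rewrite leNgt; apply/negP => p0.
have [|d d_gt0 pd] := @poly_cont R 0 p (- p.[0]); first by rewrite oppr_gt0.
pose t := Num.min (d / 2) (1 / 2).
have t_gt0 : 0 < t by rewrite lt_min !divr_gt0.
have td : t < d by rewrite gt_min; apply/orP; left; lra.
have t1 : t < 1 by rewrite gt_min; apply/orP; right; lra.
have := pd t; rewrite subr0 gtr0_norm // => /(_ td).
have := p_ge0 t; rewrite t_gt0 t1 => /(_ isT) pt.
rewrite ltr_norml => /andP[_]; lra.
Qed.

(** Moving by [t] towards the constant matrix makes all entries positive, keeps the row and column
    sums, and scales the squared deviation by [(1 - t)^2]. The positive case then gives a polynomial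
    inequality on [0 < t < 1] that extends to [t = 0]. *)
Lemma rper_stochastic_ge (R : realType) n (I : eqType) (a : I -> 'rV[R]_n)
    (S : {set 'I_n}) (s : seq I) :
  uniq s -> size s = #|S| -> (1 < #|S|)%N ->
  (forall i j, i \in s -> j \in S -> 0 <= a i 0 j) ->
  (forall i, i \in s -> row_stochastic S (a i)) ->
  (forall j, j \in S -> \sum_(i <- s) a i 0 j = 1) ->
  (#|S|)`!%:R / #|S|%:R ^+ #|S| * (1 + (2 * #|S|%:R - 1)^-1 *
     \sum_(i <- s) \sum_(j in S) (a i 0 j - #|S|%:R^-1) ^+ 2)
  <= rper (map a s) S.
Proof.
move=> us szS cS a_ge0 a_row a_col; set N := #|S| in szS cS *.
set m : R := N`!%:R / _; set c := (2 * _ - 1)^-1; set D := \sum_(i <- s) _.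
have N_gt0 : 0 < N%:R :> R by rewrite ltr0n ltnW.
pose w i := const_mx N%:R^-1 - a i.
have cst_sum (x : R) : \sum_(j in S) x = N%:R * x by rewrite sumr_const -[LHS]mulr_natl.
have cst_sum' (x : R) : \sum_(i <- s) x = N%:R * x.
  by rewrite big_const_seq count_predT szS iter_addr_0 -[LHS]mulr_natl.
pose p := rper [seq line_row (a i) (w i) | i <- s] S
  - m%:P * (1 + (c * D)%:P * (1 - 'X) ^+ 2).
have pE t : p.[t] =
    rper [seq a i + t *: w i | i <- s] S - m * (1 + c * D * (1 - t) ^+ 2).
  by rewrite hornerD hornerN rper_line_horner !hornerE.
have : 0 <= p.[0].
  apply: horner0_ge0 => t /andP[t0 t1]; rewrite pE subr_ge0.
  have wE i j : (a i + t *: w i) 0 j = (1 - t) * a i 0 j + t * N%:R^-1.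
    by rewrite !mxE; ring.
  have := @rper_stochastic_gt0_ge R n I (fun i => a i + t *: w i) S s us szS cS.
  rewrite -/N -/m -/c.
  have -> : \sum_(i <- s) \sum_(j in S) ((a i + t *: w i) 0 j - N%:R^-1) ^+ 2 =
      D * (1 - t) ^+ 2.
    rewrite mulr_suml; apply: eq_bigr => i _; rewrite mulr_suml.
    by apply: eq_bigr => j _; rewrite wE; ring.
  rewrite mulrA; apply => [i is_ j jS|i is_|j jS].
  - rewrite wE ltr_wpDl ?mulr_gt0 ?invr_gt0 //.
    by rewrite mulr_ge0 ?a_ge0 // subr_ge0 ltW.
  - rewrite /row_stochastic; under eq_bigr do rewrite wE.
    rewrite big_split /= -mulr_sumr a_row // cst_sum mulrCA divff ?gt_eqF //.
    by rewrite !mulr1 subrK.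
  - under eq_bigr do rewrite wE.
    rewrite big_split /= -mulr_sumr a_col // cst_sum' mulrCA divff ?gt_eqF //.
    by rewrite !mulr1 subrK.
rewrite pE subr_ge0 subr0 expr1n mulr1; congr (_ <= _).
by apply: rper_eq_in => i j _; rewrite scale0r addr0.
Qed.

(** * Derivative along a segment and quadratic forms of row differences *)

Lemma rper_deriv (R : comNzRingType) n (I : eqType) (r : I -> 'rV[{poly R}]_n) s
    (S : {set 'I_n}) :
  uniq s -> (rper (map r s) S)^`() =
  \sum_(i <- s) rper (map_mx deriv (r i) :: map r (rem i s)) S.
Proof.
elim: s S => [|h s IH] S /=; first by rewrite big_nil derivC.
move=> /andP[hs us]; rewrite raddf_sum /=.
under eq_bigr do rewrite derivM IH //.
rewrite big_split /= big_cons /= eqxx; congr (_ + _).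
  by apply: eq_bigr => j _; rewrite mxE.
under eq_bigr do rewrite mulr_sumr.
rewrite exchange_big /= big_seq [RHS]big_seq; apply: eq_bigr => i is_.
have /negPf-> : h != i by apply: contraNneq hs => ->.
exact: (rper_swap (r h) (map_mx deriv (r i))).
Qed.

Lemma deriv_line_row (R : comNzRingType) n (u w : 'rV[R]_n) :
  map_mx deriv (line_row u w) = map_mx polyC w.
Proof.
by apply/rowP => j; rewrite !mxE derivD derivC add0r derivM derivX derivC mul1r mulr0 addr0.
Qed.

Lemma rper_line_deriv (R : comNzRingType) n (I : eqType) (u w : I -> 'rV[R]_n) s
    (S : {set 'I_n}) t :
  uniq s -> (rper [seq line_row (u i) (w i) | i <- s] S)^`().[t] =
  \sum_(i <- s) rper (w i :: [seq u k + t *: w k | k <- rem i s]) S.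
Proof.
move=> us; rewrite rper_deriv // horner_sum; apply: eq_bigr => i _.
rewrite deriv_line_row -horner_evalE rper_map /= -map_comp.
congr (rper (_ :: _) _); first by apply/rowP => j; rewrite !mxE /= /horner_eval hornerC.
by apply: eq_map => k; apply/rowP => j; rewrite !mxE /= /horner_eval !hornerE.
Qed.

(* Symmetrizing over pairs of rows leaves only the quadratic forms of the row differences. *)
Lemma rper_replace_row_le (R : realFieldType) n (I : eqType) (B F : I -> 'rV[R]_n)
    t c (s : seq I) (S : {set 'I_n}) :
  uniq s -> 0 <= t -> \sum_(i <- s) F i = 0 ->
  (forall i k, B i - B k = t *: (F i - F k)) ->
  (forall i k, i \in s -> k \in s -> i != k ->
    - rper [:: F i - F k, F i - F k & map B (rem k (rem i s))] S
    <= c * \sum_(j in S) (F i - F k) 0 j ^+ 2) ->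
  \sum_(i <- s) rper (F i :: map B (rem i s)) S <=
  t * c * \sum_(i <- s) \sum_(j in S) F i 0 j ^+ 2.
Proof.
move=> us t_ge0 F0 BF Qle.
have [s0|s_gt0] := posnP (size s).
  by rewrite (size0nil s0) !big_nil mulr0.
(* [P i x] is the permanent of [B] with its row [i] replaced by [x]. The mixed terms of [E] cancel
   in the double sum by [F0], whereas each single [E i k] is [t] times the quadratic form at
   [F i - F k]. *)
pose P i x := rper (x :: map B (rem i s)) S.
pose E i k := P k (F i) + P i (F k) - P i (F i) - P k (F k).
have P0 i : \sum_(k <- s) P i (F k) = 0.
  by rewrite -(rper_sum s xpredT F (map B (rem i s)) S) F0 rper0.
set G := \sum_(i <- s) P i (F i).
have cst_sum (x : R) : \sum_(i <- s) x = (size s)%:R * x.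
  by rewrite big_const_seq count_predT iter_addr_0 -[LHS]mulr_natl.
have sumE : \sum_(i <- s) \sum_(k <- s) E i k = - (2 * (size s)%:R * G).
  under eq_bigr do rewrite sumrB sumrB big_split /= P0 addr0 cst_sum.
  rewrite sumrB sumrB exchange_big /= big1 => [|k _]; last exact: P0.
  by rewrite cst_sum -mulr_sumr -/G; ring.
have Ele i k : i \in s -> k \in s -> - E i k <= t * c * \sum_(j in S) (F i - F k) 0 j ^+ 2.
  move=> is_ ks; have [<-|ik] := eqVneq i k.
    rewrite subrr big1 => [|j _]; last by rewrite mxE expr0n.
    by rewrite mulr0 /E; lra.
  rewrite -mulrA; apply: le_trans (ler_wpM2l t_ge0 (Qle i k is_ ks ik)).
  set rs := map B (rem k (rem i s)).
  have ki : k \in rem i s by rewrite mem_rem_uniq // inE ks eq_sym ik.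
  have Pi x : P i x = rper [:: x, B k & rs] S.
    by apply: rper_perm; rewrite perm_cons -map_cons; apply: perm_map; apply: perm_to_rem.
  have Pk x : P k x = rper [:: x, B i & rs] S.
    apply: rper_perm; rewrite perm_cons -map_cons; apply: perm_map.
    rewrite -(perm_cons k) perm_sym.
    have pks : perm_eq (i :: k :: rem k (rem i s)) s.
      rewrite perm_sym; apply: perm_trans (perm_to_rem is_) _.
      by rewrite perm_cons; apply: perm_to_rem.
    apply: perm_trans (perm_to_rem ks); apply: perm_trans pks.
    by rewrite -[k :: i :: _]/([:: k] ++ [:: i] ++ _) perm_catCA.
  have D1 x y v : rper (x - y :: v) S = rper (x :: v) S - rper (y :: v) S.
    by rewrite rperD -scaleN1r rperZ mulN1r.
  have -> : E i k = t * rper [:: F i - F k, F i - F k & rs] S.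
    have D2 x : rper [:: x, B i - B k & rs] S = P k x - P i x.
      by rewrite rper_swap D1 Pk Pi ![rper [:: B _, _ & _] _]rper_swap.
    by rewrite -rperZ -BF rper_swap D1 !D2 /E; ring.
  by rewrite mulrN.
have sumsq : \sum_(i <- s) \sum_(k <- s) \sum_(j in S) (F i - F k) 0 j ^+ 2 =
    2 * (size s)%:R * \sum_(i <- s) \sum_(j in S) F i 0 j ^+ 2.
  have cross i : \sum_(k <- s) \sum_(j in S) F i 0 j * F k 0 j = 0.
    rewrite exchange_big big1 //= => j _; rewrite -mulr_sumr.
    by have /rowP/(_ j) := F0; rewrite summxE !mxE => ->; rewrite mulr0.
  pose d i := \sum_(j in S) F i 0 j ^+ 2.
  transitivity (\sum_(i <- s) \sum_(k <- s)
      (d i + d k - 2 * \sum_(j in S) F i 0 j * F k 0 j)).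
    apply: eq_bigr => i _; apply: eq_bigr => k _.
    rewrite /d mulr_sumr -big_split -sumrB /=; apply: eq_bigr => j _.
    by rewrite !mxE; ring.
  under eq_bigr do rewrite sumrB big_split /= cst_sum -mulr_sumr cross mulr0 subr0.
  by rewrite big_split /= cst_sum -mulr_sumr -/(\sum_(i <- s) d i) /d; ring.
have szR : 0 < 2 * (size s)%:R :> R by rewrite mulr_gt0 // ltr0n.
rewrite -(ler_pM2l szR) -/G -[X in X <= _]opprK -sumE -sumrN.
rewrite mulrCA -sumsq mulr_sumr big_seq [X in _ <= X]big_seq.
apply: ler_sum => i is_; rewrite -sumrN mulr_sumr big_seq [X in _ <= X]big_seq.
by apply: ler_sum => k ks; apply: Ele.
Qed.

(** Each minor is compared with the midpoint [(lo + hi) / 2]. As [D] sums to zero, the off-diagonal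
    products sum to minus the sum of squares, which settles the midpoint part; the deviation is
    absorbed by squares. *)
Lemma rper_quad_le (R : realFieldType) n (D : 'rV[R]_n) rs (S : {set 'I_n}) lo hi :
  \sum_(j in S) D 0 j = 0 ->
  (forall j l, j \in S -> l \in S -> j != l -> lo <= rper rs (S :\ j :\ l) <= hi) ->
  - rper [:: D, D & rs] S <=
  (#|S|%:R * hi - (#|S|%:R - 2) * lo) / 2 * \sum_(j in S) D 0 j ^+ 2.
Proof.
move=> D0 bounds; set N : R := #|S|%:R; set T := \sum_(j in S) _.
have rest (f : 'I_n -> R) j : j \in S ->
    \sum_(l in S :\ j) f l = \sum_(l in S) f l - f j.
  by move=> jS; rewrite (big_setD1 (A := S) j jS) /= [f j + _]addrC addrK.
pose q j l := - ((lo + hi) / 2) * (D 0 j * D 0 l)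
  + (hi - lo) / 4 * (D 0 j ^+ 2 + D 0 l ^+ 2).
have term j l : j \in S -> l \in S :\ j ->
    - (D 0 j * (D 0 l * rper rs (S :\ j :\ l))) <= q j l.
  move=> jS /setD1P[lj lS].
  have jl : j != l by rewrite eq_sym.
  have /andP[] := bounds j l jS lS jl.
  rewrite /q; move: (rper _ _) (D 0 j) (D 0 l) => M x y loM Mhi.
  (* The sum of these two nonnegative terms is four times the claimed gap. *)
  have p1 : 0 <= (hi - M) * (x - y) ^+ 2 by rewrite mulr_ge0 ?sqr_ge0 ?subr_ge0.
  have p2 : 0 <= (M - lo) * (x + y) ^+ 2 by rewrite mulr_ge0 ?sqr_ge0 ?subr_ge0.
  move: p1 p2; lra.
apply: le_trans (_ : \sum_(j in S) \sum_(l in S :\ j) q j l <= _).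
  rewrite /= -sumrN; apply: ler_sum => j jS; rewrite mulr_sumr -sumrN.
  by apply: ler_sum => l lS; apply: term.
rewrite le_eqVlt; apply/orP; left; apply/eqP.
transitivity (\sum_(j in S) ((lo + hi) / 2 * D 0 j ^+ 2
    + (hi - lo) / 4 * ((N - 2) * D 0 j ^+ 2 + T))).
  apply: eq_bigr => j jS; rewrite rest // /q big_split /= -!mulr_sumr.
  rewrite D0 big_split /= -/T sumr_const -[_ *+ _]mulr_natl -/N; ring.
rewrite big_split -!mulr_sumr big_split /= -mulr_sumr -/T sumr_const.
by rewrite -[_ *+ _]mulr_natl -/N; field.
Qed.

(** * Bonferroni and van der Waerden bounds for minors *)

Definition entry_sum (R : numDomainType) n (I : Type) (a : I -> 'rV[R]_n) (s : seq I)
    (S : {set 'I_n}) : R := \sum_(i <- s) \sum_(j in S) a i 0 j.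

(* Sum of [a i 0 j * a k 0 l] over the pairs of rows [i] before [k] and columns [j != l]. *)
Fixpoint entry_pairs (R : numDomainType) n (I : Type) (a : I -> 'rV[R]_n) (s : seq I)
    (S : {set 'I_n}) : R :=
  if s is i :: s' then \sum_(j in S) a i 0 j * entry_sum a s' (S :\ j) + entry_pairs a s' S
  else 0.

(** For a row of [A] this is, up to the factor [(n - 1)^-1], the corresponding row of
    [marcus_minc A]. *)
Definition compl_row (R : numDomainType) n (x : 'rV[R]_n) : 'rV[R]_n := const_mx 1 - x.

Lemma sum_setD1 (R : zmodType) n (f : 'I_n -> R) (S : {set 'I_n}) j : j \in S ->
  \sum_(l in S :\ j) f l = \sum_(l in S) f l - f j.
Proof. by move=> jS; rewrite (big_setD1 (A := S) j jS) /= [f j + _]addrC addrK. Qed.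

Lemma entry_sum_setD1 (R : numDomainType) n (I : Type) (a : I -> 'rV[R]_n) s (S : {set 'I_n}) j :
  j \in S -> entry_sum a s (S :\ j) = entry_sum a s S - \sum_(i <- s) a i 0 j.
Proof.
by move=> jS; rewrite /entry_sum -sumrB; apply: eq_bigr => i _; rewrite sum_setD1.
Qed.

Lemma sum_entry_sum_setD1 (R : numDomainType) n (I : Type) (a : I -> 'rV[R]_n) s
    (S : {set 'I_n}) :
  \sum_(j in S) entry_sum a s (S :\ j) = (#|S|%:R - 1) * entry_sum a s S.
Proof.
rewrite (eq_bigr _ (fun j jS => entry_sum_setD1 a s jS)) sumrB sumr_const.
by rewrite exchange_big /= -[_ *+ _]mulr_natl -/(entry_sum a s S); ring.
Qed.

(** A pair of entries in two different columns disappears only when one of these two columns is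
    deleted. *)
Lemma sum_pairs_setD1 (R : numDomainType) n (I : Type) (a : I -> 'rV[R]_n) s
    (S : {set 'I_n}) :
  \sum_(j in S) entry_pairs a s (S :\ j) = (#|S|%:R - 2) * entry_pairs a s S.
Proof.
elim: s => [|i s IH] /=; first by rewrite mulr0 big1.
rewrite big_split /= IH mulrDr; congr (_ + _).
rewrite (exchange_big_dep (mem S)) /=; last by move=> j l _ /setD1P[].
rewrite mulr_sumr; apply: eq_bigr => l lS.
transitivity (a i 0 l * \sum_(j in S :\ l) entry_sum a s (S :\ l :\ j)).
  rewrite mulr_sumr; apply: eq_big => [j|j /andP[jS ljS]].
    by rewrite !in_setD1 lS andbT eq_sym andbC.
  by rewrite !setDDl setUC.
by rewrite sum_entry_sum_setD1 (cardsD1 l S) lS add1n -natr1; ring.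
Qed.

(** Inclusion-exclusion on the square of the total: pairs sharing a row and pairs sharing a column
    are removed, and the squares of single entries, removed twice, are restored once. *)
Lemma pairs_closed (R : numDomainType) n (I : Type) (a : I -> 'rV[R]_n) s
    (S : {set 'I_n}) :
  2 * entry_pairs a s S = entry_sum a s S ^+ 2 - \sum_(i <- s) (\sum_(j in S) a i 0 j) ^+ 2
    - \sum_(j in S) (\sum_(i <- s) a i 0 j) ^+ 2
    + \sum_(i <- s) \sum_(j in S) a i 0 j ^+ 2.
Proof.
elim: s => [|i s IH].
  rewrite /= /entry_sum !big_nil expr0n mulr0 !subr0 addr0 add0r.
  by rewrite big1 ?oppr0 // => j _; rewrite big_nil expr0n.
rewrite [entry_pairs _ _ _]/= mulrDr IH.
under eq_bigr => j jS do rewrite entry_sum_setD1 // mulrBr.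
rewrite sumrB -mulr_suml {IH} [entry_sum a (i :: s) S]/entry_sum !big_cons -/(entry_sum a s S).
have -> : \sum_(j in S) (\sum_(k <- i :: s) a k 0 j) ^+ 2 =
    \sum_(j in S) a i 0 j ^+ 2 + 2 * \sum_(j in S) a i 0 j * \sum_(k <- s) a k 0 j
    + \sum_(j in S) (\sum_(k <- s) a k 0 j) ^+ 2.
  rewrite mulr_sumr -!big_split /=; apply: eq_bigr => j _.
  by rewrite big_cons; ring.
ring.
Qed.

Lemma pairs_small (R : numDomainType) n (I : Type) (a : I -> 'rV[R]_n) s
    (S : {set 'I_n}) : (size s <= 1)%N -> entry_pairs a s S = 0.
Proof.
case: s => [//|i [|//]] _ /=; rewrite addr0 big1 // => j _.
by rewrite /entry_sum big_nil mulr0.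
Qed.

Lemma rper_compl_ge (R : numDomainType) n (I : Type) (a : I -> 'rV[R]_n) s
    (S : {set 'I_n}) : size s = #|S| ->
  (forall i j, j \in S -> 0 <= a i 0 j <= 1) ->
  (size s)`!%:R - (size s).-1`!%:R * entry_sum a s S <= rper [seq compl_row (a i) | i <- s] S.
Proof.
elim: s S => [|i s IH] S szS a01; first by rewrite /entry_sum big_nil mulr0 subr0.
set k := size s in IH *; have szD j : j \in S -> k = #|S :\ j|.
  by move=> jS; move: szS; rewrite (cardsD1 j S) jS => -[].
rewrite [rper _ _]/=.
apply: le_trans (_ : \sum_(j in S) (1 - a i 0 j) *
  (k`!%:R - k.-1`!%:R * entry_sum a s (S :\ j)) <= _); last first.
  apply: ler_sum => j jS; rewrite !mxE ler_wpM2l //.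
    by have /andP[_] := a01 i j jS; rewrite subr_ge0.
  by apply: IH => [|i' l /setD1P[_ lS]]; [apply: szD|apply: a01].
apply: le_trans (_ : \sum_(j in S) (k`!%:R - k.-1`!%:R * entry_sum a s (S :\ j)
   - k`!%:R * a i 0 j) <= _); last first.
  apply: ler_sum => j jS; rewrite -subr_ge0.
  rewrite [X in 0 <= X](_ : _ = k.-1`!%:R * (a i 0 j * entry_sum a s (S :\ j))); last by ring.
  rewrite mulr_ge0 // mulr_ge0 //; first by have /andP[] := a01 i j jS.
  apply: sumr_ge0 => i' _; apply: sumr_ge0 => l /setD1P[_ lS].
  by have /andP[] := a01 i' l lS.
rewrite !sumrB -!mulr_sumr sum_entry_sum_setD1 sumr_const -szS /= -/k -[_ *+ _]mulr_natl.
rewrite [entry_sum a (i :: s) S]/entry_sum big_cons -/(entry_sum a s S) factS natrM.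
rewrite -natr1 addrK le_eqVlt; apply/orP; left; apply/eqP.
have -> : k`!%:R * (\sum_(j in S) a i 0 j + entry_sum a s S) =
    k.-1`!%:R * (k%:R * entry_sum a s S) + k`!%:R * \sum_(j in S) a i 0 j; last by ring.
rewrite mulrDr addrC; congr (_ + _); rewrite mulrA -natrM.
(* For [k = 0] the truncated predecessor breaks the factorial recursion, but then the entry sum is
   empty. *)
case Dk: k => [|k']; last by rewrite factS mulnC.
by move/size0nil: Dk => ->; rewrite /entry_sum big_nil !mulr0.
Qed.

Lemma rper_compl_le (R : numDomainType) n (I : Type) (a : I -> 'rV[R]_n) s
    (S : {set 'I_n}) : size s = #|S| ->
  (forall i j, j \in S -> 0 <= a i 0 j <= 1) ->
  rper [seq compl_row (a i) | i <- s] S <=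
  (size s)`!%:R - (size s).-1`!%:R * entry_sum a s S + (size s).-2`!%:R * entry_pairs a s S.
Proof.
elim: s S => [|i s IH] S szS a01.
  by rewrite /entry_sum big_nil /= !mulr0 subr0 addr0.
set k := size s in IH *; have szD j : j \in S -> k = #|S :\ j|.
  by move=> jS; move: szS; rewrite (cardsD1 j S) jS => -[].
rewrite [rper _ _]/=.
apply: le_trans (_ : \sum_(j in S) (k`!%:R - k.-1`!%:R * entry_sum a s (S :\ j)
  + k.-2`!%:R * entry_pairs a s (S :\ j)
  - a i 0 j * (k`!%:R - k.-1`!%:R * entry_sum a s (S :\ j))) <= _).
  apply: ler_sum => j jS; rewrite !mxE mulrBl mul1r.
  have a01' i' l : l \in S :\ j -> 0 <= a i' 0 l <= 1.
    by move=> /setD1P[_ lS]; apply: a01.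
  apply: lerB; first by apply: IH => //; apply: szD.
  rewrite ler_wpM2l //; first by have /andP[] := a01 i j jS.
  by apply: rper_compl_ge => //; apply: szD.
rewrite !sumrB big_split sumrB /= -!mulr_sumr sum_entry_sum_setD1 sum_pairs_setD1.
have -> : \sum_(j in S) a i 0 j * (k`!%:R - k.-1`!%:R * entry_sum a s (S :\ j)) =
    k`!%:R * \sum_(j in S) a i 0 j
    - k.-1`!%:R * \sum_(j in S) a i 0 j * entry_sum a s (S :\ j).
  by rewrite !mulr_sumr -sumrB; apply: eq_bigr => j _; ring.
rewrite sumr_const -szS /= -/k -[_ *+ _]mulr_natl.
rewrite [entry_sum a (i :: s) S]/entry_sum big_cons -/(entry_sum a s S) factS natrM.
rewrite -natr1; set A := \sum_(j in S) a i 0 j; set T := entry_sum a s S.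
set Q := \sum_(j in S) _; set P := entry_pairs a s S.
have kT : k`!%:R * T = k.-1`!%:R * (k%:R * T).
  rewrite mulrA -natrM; rewrite /T.
  case Dk: k => [|k']; last by rewrite factS mulnC.
  by move/size0nil: Dk => ->; rewrite /entry_sum big_nil !mulr0.
have kP : k.-1`!%:R * P = k.-2`!%:R * ((k%:R - 1) * P).
  have [k1|k2] := leqP k 1; first by rewrite /P pairs_small ?mulr0.
  rewrite mulrA; congr (_ * _); case: (k) k2 => [|[|k']] //= _.
  by rewrite factS natrM mulrC -[k'.+2%:R]natr1 addrK.
rewrite le_eqVlt; apply/orP; left; apply/eqP.
rewrite [k`!%:R * (A + T)]mulrDr kT [k.-1`!%:R * (Q + P)]mulrDr kP; ring.
Qed.

Lemma sumsq_le (R : numDomainType) I (s : seq I) (f : I -> R) :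
  (forall i, 0 <= f i) -> \sum_(i <- s) f i ^+ 2 <= (\sum_(i <- s) f i) ^+ 2.
Proof.
move=> f_ge0; elim: s => [|i s IH]; first by rewrite !big_nil expr0n.
have s_ge0 : 0 <= \sum_(k <- s) f k by apply: sumr_ge0.
rewrite !big_cons sqrrD -addrA lerD2l (le_trans IH) // lerDr.
by rewrite mulrn_wge0 // mulr_ge0.
Qed.

Lemma sumsq_ge_mean (R : realFieldType) I (s : seq I) (f : I -> R) :
  (\sum_(i <- s) f i) ^+ 2 <= (size s)%:R * \sum_(i <- s) f i ^+ 2.
Proof.
elim: s => [|i s IH]; first by rewrite !big_nil expr0n mul0r.
rewrite !big_cons /= -natr1; move: IH; set x := f i; set k : R := (size s)%:R.
set T := \sum_(k <- s) f k; set Q := \sum_(k <- s) f k ^+ 2 => IH.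
have [k0|k_gt0] := eqVneq k 0.
  move: IH; rewrite k0 mul0r => T2.
  have T0 : T = 0 by apply/eqP; rewrite -sqrf_eq0 eq_le T2 sqr_ge0.
  have Q_ge0 : 0 <= Q by apply: sumr_ge0 => j _; apply: sqr_ge0.
  by rewrite T0 addr0 add0r mul1r lerDl.
have k0 : 0 < k by rewrite lt_neqAle eq_sym k_gt0 ler0n.
have step := sqr_ge0 (k * x - T).
rewrite -(ler_pM2l k0); move: IH step; nra.
Qed.

(** With [N] rows and total [T], the squared entries are at most the squared column sums, and the
    squared row sums add up to at least [T^2 / N], so the pair sum is at most [(N - 1) T^2 / (2 N)].
    The second Bonferroni bound becomes [(N - 2)! (N - 1) (N^2 + (N - T)^2) / (2 N)], where
    [(N - T)^2 <= 4]. *)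
Lemma rper_compl_hi (R : realFieldType) n (I : Type) (a : I -> 'rV[R]_n) s
    (S : {set 'I_n}) : size s = #|S| -> (1 < size s)%N ->
  (forall i j, j \in S -> 0 <= a i 0 j <= 1) ->
  (size s)%:R - 2 <= entry_sum a s S <= (size s)%:R ->
  rper [seq compl_row (a i) | i <- s] S <=
  (size s)`!%:R * (1 / 2 + 2 / (size s)%:R ^+ 2).
Proof.
move=> szS s_gt1 a01 /andP[tot_ge tot_le].
apply: le_trans (rper_compl_le szS a01) _.
have := pairs_closed a s S; have := sumsq_ge_mean s (fun i => \sum_(j in S) a i 0 j).
have : \sum_(i <- s) \sum_(j in S) a i 0 j ^+ 2 <= \sum_(j in S) (\sum_(i <- s) a i 0 j) ^+ 2.
  rewrite exchange_big /=; apply: ler_sum => j jS.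
  by apply: sumsq_le => i; have /andP[] := a01 i j jS.
rewrite -/(entry_sum a s S); move: tot_ge tot_le.
set T := entry_sum a s S; set P := entry_pairs a s S; set Q := \sum_(i <- s) _ ^+ 2.
set U := \sum_(i <- s) _; set V := \sum_(j in S) _.
move: s_gt1; rewrite {szS}; case: (size s) => [//|[//|k]] _ T_ge T_le UV TQ eP.
rewrite /= !factS !natrM; set N : R := k.+2%:R.
have k1 : k.+1%:R = N - 1 :> R by rewrite /N -[k.+2%:R]natr1 addrK.
rewrite -/N in T_ge T_le TQ *; rewrite k1; set f : R := k`!%:R.
have f_gt0 : 0 < f by rewrite ltr0n fact_gt0.
have N_ge2 : 2 <= N by rewrite ler_nat.
clearbody N f; have N_gt0 : 0 < N by lra.
have P_le : 2 * N * P <= (N - 1) * T ^+ 2.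
  have : N * (2 * P) <= N * (T ^+ 2 - Q) by rewrite ler_pM2l // eP; lra.
  lra.
have sq : (N - T) ^+ 2 <= 4 by nra.
have -> : N * ((N - 1) * f) * (1 / 2 + 2 / N ^+ 2) = f * ((N - 1) * (N / 2 + 2 / N)).
  by field; rewrite gt_eqF.
have -> : N * ((N - 1) * f) - (N - 1) * f * T + f * P =
   f * (N * (N - 1) - (N - 1) * T + P) by ring.
rewrite ler_pM2l // -(ler_pM2l N_gt0).
have -> : N * ((N - 1) * (N / 2 + 2 / N)) = (N - 1) * (N ^+ 2 / 2 + 2).
  by field; rewrite gt_eqF.
have : 0 <= (N - 1) * (4 - (N - T) ^+ 2) by rewrite mulr_ge0 // subr_ge0 //; lra.
move: P_le; lra.
Qed.

Lemma rper_le (R : numDomainType) n (I : eqType) (x y : I -> 'rV[R]_n) s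
    (S : {set 'I_n}) :
  (forall i j, i \in s -> j \in S -> 0 <= x i 0 j <= y i 0 j) ->
  rper (map x s) S <= rper (map y s) S.
Proof.
elim: s S => [//|i s IH] S xy /=; apply: ler_sum => j jS.
have /andP[x_ge0 x_le] := xy i j (mem_head i s) jS.
have xy' k l : k \in s -> l \in S :\ j -> 0 <= x k 0 l <= y k 0 l.
  by move=> ks /setD1P[_ lS]; apply: xy => //; rewrite in_cons ks orbT.
apply: ler_pM => //; last exact: IH.
by apply: rper_ge0 => z /mapP[k ks ->] l lS; have /andP[] := xy' k l ks lS.
Qed.

(* Adding the rank-one defect [(1 - r) (1 - c)^T] completes a substochastic matrix to a
   stochastic one, to which the van der Waerden bound applies. *)
Lemma rper_compl_lo (R : realType) n (I : eqType) (a : I -> 'rV[R]_n) s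
    (S : {set 'I_n}) : uniq s -> size s = #|S| -> (1 < #|S|)%N ->
  (forall i j, i \in s -> j \in S -> 0 <= a i 0 j) ->
  (forall i, i \in s -> \sum_(j in S) a i 0 j <= 1) ->
  (forall j, j \in S -> \sum_(i <- s) a i 0 j <= 1) ->
  (#|S|)`!%:R * ((#|S|%:R - 1) / #|S|%:R) ^+ #|S| <=
  rper [seq compl_row (a i) | i <- s] S.
Proof.
move=> us szS cS a_ge0 a_row a_col; set N := #|S| in szS cS *.
pose r i := 1 - \sum_(j in S) a i 0 j; pose c j := 1 - \sum_(i <- s) a i 0 j.
have r_ge0 i : i \in s -> 0 <= r i by move=> is_; rewrite subr_ge0 a_row.
have c_ge0 j : j \in S -> 0 <= c j by move=> jS; rewrite subr_ge0 a_col.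
have cst_sum (x : R) : \sum_(j in S) x = N%:R * x by rewrite sumr_const -[LHS]mulr_natl.
have cst_sum' (x : R) : \sum_(i <- s) x = N%:R * x.
  by rewrite big_const_seq count_predT szS iter_addr_0 -[LHS]mulr_natl.
pose d := \sum_(i <- s) r i.
have dE : d = \sum_(j in S) c j.
  by rewrite /d /r /c !sumrB cst_sum cst_sum' exchange_big.
have r0 i : d = 0 -> i \in s -> r i = 0.
  move=> d0 is_; apply/eqP; rewrite eq_le r_ge0 // andbT -d0 /d.
  rewrite (perm_big _ (perm_to_rem is_)) big_cons lerDl big_seq.
  by apply: sumr_ge0 => k /mem_rem; apply: r_ge0.
have c0 j : d = 0 -> j \in S -> c j = 0.
  move=> d0 jS; apply/eqP; rewrite eq_le c_ge0 // andbT -d0 dE.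
  rewrite (bigD1 j) //= lerDl.
  by apply: sumr_ge0 => k /andP[kS _]; apply: c_ge0.
have d_ge0 : 0 <= d by rewrite dE; apply: sumr_ge0.
(* If [d = 0], all defects vanish and the quotient by zero is zero, so [a'] is still the wanted
   completion. *)
pose a' i := \row_j (a i 0 j + r i * c j / d).
have a'_ge i j : i \in s -> j \in S -> a i 0 j <= a' i 0 j.
  by move=> is_ jS; rewrite mxE lerDl divr_ge0 // mulr_ge0 ?r_ge0 ?c_ge0.
have a'_row i : i \in s -> \sum_(j in S) a' i 0 j = 1.
  move=> is_; under eq_bigr do rewrite mxE.
  rewrite big_split /= -mulr_suml -mulr_sumr -dE.
  have [d0|d0] := eqVneq d 0; last by rewrite mulfK // /r addrC subrK.
  by have := r0 i d0 is_; rewrite d0 /r => ri; rewrite ri; lra.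
have a'_col j : j \in S -> \sum_(i <- s) a' i 0 j = 1.
  move=> jS; under eq_bigr do rewrite mxE.
  rewrite big_split /= -mulr_suml -mulr_suml -/d.
  have [d0|d0] := eqVneq d 0; last by rewrite mulrC mulKf // /c addrC subrK.
  by have := c0 j d0 jS; rewrite d0 /c => cj; rewrite cj; lra.
have a'_le1 i j : i \in s -> j \in S -> a' i 0 j <= 1.
  move=> is_ jS; rewrite -(a'_row i is_) (bigD1 j) //= lerDl.
  apply: sumr_ge0 => l /andP[lS _].
  exact: le_trans (a_ge0 i l is_ lS) (a'_ge i l is_ lS).
have N1 : 1 < N%:R :> R by rewrite ltr1n.
(* The complement of the completed matrix has line sums [N - 1]; rescaled by this it is doubly
   stochastic. *)
pose x i := (N%:R - 1)^-1 *: compl_row (a' i).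
have xE i j : x i 0 j = (N%:R - 1)^-1 * (1 - a' i 0 j) by rewrite !mxE.
have x_vdw : N`!%:R / N%:R ^+ N <= rper (map x s) S.
  have x_sum : (N%:R - 1)^-1 * (N%:R * 1 - 1) = 1 :> R.
    by rewrite mulr1 mulVf // gt_eqF // subr_gt0.
  apply: le_trans (rper_stochastic_ge us szS cS _ _ _) => [|i j is_ jS|i is_|j jS].
  - rewrite -/N ler_peMr //; first by rewrite divr_ge0 // exprn_ge0.
    rewrite lerDl mulr_ge0 ?invr_ge0 //; first by clear -N1; lra.
    by apply: sumr_ge0 => i _; apply: sumr_ge0 => j _; apply: sqr_ge0.
  - by rewrite xE mulr_ge0 ?invr_ge0 ?subr_ge0 ?a'_le1 // ltW.
  - rewrite /row_stochastic; under eq_bigr do rewrite xE.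
    by rewrite -mulr_sumr sumrB a'_row // cst_sum x_sum.
  - under eq_bigr do rewrite xE.
    by rewrite -mulr_sumr sumrB a'_col // cst_sum' x_sum.
apply: le_trans (_ : rper [seq compl_row (a' i) | i <- s] S <= _); last first.
  apply: rper_le => i j is_ jS; rewrite !mxE.
  by have := a'_ge i j is_ jS; have := a'_le1 i j is_ jS; rewrite !mxE; lra.
have -> : rper [seq compl_row (a' i) | i <- s] S = (N%:R - 1) ^+ N * rper (map x s) S.
  rewrite -[N in _ ^+ N]szS -[size s](size_map x) -rperZ_all -map_comp.
  congr (rper _ _); apply: eq_map => i /=.
  by rewrite /x scalerA divff ?scale1r // gt_eqF // subr_gt0.
rewrite expr_div_n mulrCA mulrA -[X in X <= _]mulrA.
by rewrite mulrA -[X in X <= _]mulrA ler_pM2l // exprn_gt0 // subr_gt0.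
Qed.

(* Bounds for the n x n minors of [marcus_minc A], where [A] is doubly stochastic of size n+2. *)
Definition minor_lo (R : realFieldType) n : R :=
  (n.+1%:R^-1) ^+ n * (n`!%:R * ((n%:R - 1) / n%:R) ^+ n).

Definition minor_hi (R : realFieldType) n : R :=
  (n.+1%:R^-1) ^+ n * (n`!%:R * (1 / 2 + 2 / n%:R ^+ 2)).

(** Deleting two rows and two columns leaves line sums at most 1. The entries left add up to [n - 2]
    plus the entries of the 2 x 2 block where the deleted lines cross, hence to between [n - 2] and
    [n], as [rper_compl_hi] requires. *)
Lemma minor_bounds (R : realType) n (a : 'I_n.+2 -> 'rV[R]_n.+2) i k j l :
  (1 < n)%N -> (forall i j, 0 <= a i 0 j) -> (forall i, \sum_j a i 0 j = 1) ->
  (forall j, \sum_i a i 0 j = 1) -> i != k -> j != l ->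
  minor_lo R n <= rper [seq n.+1%:R^-1 *: compl_row (a h) |
    h <- rem k (rem i (enum 'I_n.+2))] ([set: 'I_n.+2] :\ j :\ l) <= minor_hi R n.
Proof.
move=> n_gt1 a_ge0 a_row a_col ik jl; set s := rem k _; set S := _ :\ l.
have ie : i \in enum 'I_n.+2 by rewrite mem_enum.
have us0 := enum_uniq 'I_n.+2.
have us : uniq s by rewrite !rem_uniq.
have ki : k \in rem i (enum 'I_n.+2) by rewrite mem_rem_uniq // inE mem_enum eq_sym ik.
have szs : size s = n by rewrite !size_rem ?mem_enum // size_enum_ord.
have cS : #|S| = n.
  have := cardsT 'I_n.+2; rewrite card_ord (cardsD1 j) inE.
  by rewrite (cardsD1 l (_ :\ j)) !inE eq_sym jl /= !add1n => -[].
have sumS (f : 'I_n.+2 -> R) : \sum_(h in S) f h = \sum_h f h - f j - f l.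
  rewrite sum_setD1; last by rewrite !inE eq_sym jl.
  rewrite sum_setD1 ?inE //; congr (_ - _ - _).
  by apply: eq_bigl => h; rewrite inE.
have sums (f : 'I_n.+2 -> R) : \sum_(h <- s) f h = \sum_h f h - f i - f k.
  rewrite -[\sum_h f h]big_enum (perm_big _ (perm_to_rem ie)) big_cons /=.
  by rewrite (perm_big _ (perm_to_rem ki)) big_cons /= -/s; ring.
have a_le1 h m : a h 0 m <= 1.
  by rewrite -(a_row h) (bigD1 m) //= lerDl sumr_ge0.
have -> : [seq n.+1%:R^-1 *: compl_row (a h) | h <- s] =
    [seq n.+1%:R^-1 *: x | x <- [seq compl_row (a h) | h <- s]] by rewrite -map_comp.
rewrite rperZ_all size_map szs; have pow_gt0 : 0 < (n.+1%:R^-1) ^+ n :> R.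
  by rewrite exprn_gt0 // invr_gt0 ltr0n.
rewrite !ler_pM2l //; apply/andP; split.
  have := @rper_compl_lo R n.+2 _ a s S us; rewrite szs cS; apply=> // [h _|h _].
    by rewrite sumS a_row; have := a_ge0 h j; have := a_ge0 h l; lra.
  by rewrite sums a_col; have := a_ge0 i h; have := a_ge0 k h; lra.
have := @rper_compl_hi R n.+2 _ a s S; rewrite szs cS; apply=> // [h m _|].
  by rewrite a_ge0 a_le1.
rewrite /entry_sum; under eq_bigr do rewrite sumS a_row.
rewrite !sumrB big_const_seq count_predT szs iter_addr_0 !sums !a_col.
have csum_ge0 m : 0 <= 1 - a i 0 m - a k 0 m.
  by rewrite -(a_col m) -sums sumr_ge0.
have := csum_ge0 j; have := csum_ge0 l.
have := a_ge0 i j; have := a_ge0 i l; have := a_ge0 k j; have := a_ge0 k l.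
by clear; lra.
Qed.

(** * From row lists back to matrices: the two global bounds *)

(** Permutations are grouped by the image of [ord0], and [lift_perm ord0 j] parametrizes the group
    with image [j] by the smaller symmetric group. *)
Lemma permanent_expand_row0 (R : comPzRingType) n (A : 'M[R]_n.+1) :
  permanent A = \sum_j A ord0 j * permanent (row' ord0 (col' j A)).
Proof.
rewrite /permanent (partition_big (fun s : 'S_n.+1 => s ord0) xpredT) //=.
apply: eq_bigr => j _; rewrite mulr_sumr.
rewrite (reindex (lift_perm ord0 j)); last first.
  (* [ulsf] removes [i] and its image from a permutation, which inverts [lift_perm]. *)
  pose ulsf i (s : 'S_n.+1) k := odflt k (unlift (s i) (s (lift i k))).
  have ulsfK i (s : 'S_n.+1) k : lift (s i) (ulsf i s k) = s (lift i k).
    rewrite /ulsf; have := neq_lift i k.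
    by rewrite -(can_eq (permK s)) => /unlift_some[] ? ? ->.
  have inj_ulsf : injective (ulsf ord0 _).
    move=> s; apply: can_inj (ulsf (s ord0) s^-1%g) _ => k'.
    by rewrite {1}/ulsf ulsfK !permK liftK.
  exists (fun s => perm (inj_ulsf s)) => [s _ | s].
    by apply/permP => k'; rewrite permE /ulsf lift_perm_lift lift_perm_id liftK.
  move/(s _ =P _) => si0; apply/permP => k.
  case: (unliftP ord0 k) => [k'|] ->; rewrite ?lift_perm_id //.
  by rewrite lift_perm_lift -si0 permE ulsfK.
apply: eq_big => [s|s _]; first by rewrite lift_perm_id eqxx.
rewrite big_ord_recl lift_perm_id; congr (_ * _); apply: eq_bigr => i _.
by rewrite lift_perm_lift !mxE.
Qed.

(** Matches the renumbering of columns in [col'] with the removal of an element from the column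
    set. *)
Lemma rper_colsub (R : comPzRingType) n m (h : 'I_n -> 'I_m) (rs : seq 'rV[R]_m)
    (S : {set 'I_n}) :
  injective h -> rper [seq colsub h x | x <- rs] S = rper rs (h @: S).
Proof.
move=> h_inj; elim: rs S => [//|x rs IH] S /=.
rewrite big_imset => [|j l _ _ /h_inj //]; apply: eq_bigr => j jS.
rewrite IH mxE; congr (_ * rper _ _); apply/setP => l.
apply/imsetP/setD1P => [[k /setD1P[kj kS] ->]|[lj /imsetP[k kS lk]]].
  by rewrite (inj_eq h_inj) kj imset_f.
by exists k => //; rewrite in_setD1 kS -(inj_eq h_inj) -lk lj.
Qed.

Lemma permanent_rper (R : comPzRingType) n (A : 'M[R]_n) :
  permanent A = rper [seq row i A | i <- enum 'I_n] [set: 'I_n].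
Proof.
elim: n A => [|n IH] A.
  rewrite (size0nil (size_enum_ord 0)) /= /permanent (big_pred1 1%g) ?big_ord0 //.
  by move=> s; apply/esym/eqP/permP => -[].
rewrite permanent_expand_row0 enum_ordSl /=; apply: eq_big => [j|j _].
  by rewrite inE.
rewrite mxE IH; congr (_ * _).
have -> : [set: 'I_n.+1] :\ j = lift j @: [set: 'I_n].
  apply/setP => k; rewrite !inE andbT; apply/idP/imsetP => [kj|[l _ ->]].
    have /unlift_some[l -> _] : j != k by rewrite eq_sym.
    by exists l; rewrite ?inE.
  by rewrite eq_sym neq_lift.
rewrite -rper_colsub; last exact: lift_inj.
rewrite -!map_comp; congr (rper _ _); apply: eq_map => i /=.
by apply/rowP => k; rewrite !mxE.
Qed.

(** The squared Frobenius norm of [E = A - J]. *)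
Definition sqdist (R : realFieldType) n (A : 'M[R]_n) : R :=
  \sum_i \sum_j (A i j - n%:R^-1) ^+ 2.

Lemma sum_setT (R : nmodType) n (f : 'I_n -> R) :
  \sum_(j in [set: 'I_n]) f j = \sum_j f j.
Proof. by apply: eq_bigl => j; rewrite inE. Qed.

Lemma sum_enum (R : nmodType) n (f : 'I_n -> R) :
  \sum_(j <- enum 'I_n) f j = \sum_j f j.
Proof. by rewrite big_enum. Qed.

Lemma permanent_ge (R : realType) n (A : 'M[R]_n) : (1 < n)%N ->
  doubly_stochastic A ->
  n`!%:R / n%:R ^+ n * (1 + (2 * n%:R - 1)^-1 * sqdist A) <= permanent A.
Proof.
move=> n1 [A_ge0 A_row A_col]; rewrite permanent_rper.
have := @rper_stochastic_ge R n _ (fun i => row i A) [set: 'I_n] (enum 'I_n).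
rewrite cardsT card_ord size_enum_ord enum_uniq sum_enum.
have -> : \sum_i \sum_(j in [set: 'I_n]) (row i A 0 j - n%:R^-1) ^+ 2 = sqdist A.
  by apply: eq_bigr => i _; rewrite sum_setT; apply: eq_bigr => j _; rewrite mxE.
apply=> // [i j _ _|i _|j _]; first by rewrite mxE.
  rewrite /row_stochastic sum_setT -[RHS](A_row i).
  by apply: eq_bigr => j _; rewrite mxE.
rewrite sum_enum -[RHS](A_col j).
by apply: eq_bigr => i _; rewrite mxE.
Qed.

(** On the segment from [J] to [marcus_minc A] the derivative of the permanent at [t] is at most
    [t * K * W], by [rper_replace_row_le] and the minor bounds; integration gives [K * W / 2]. *)
Lemma permanent_marcus_minc_le (R : realType) n (A : 'M[R]_n.+2) : (1 < n)%N ->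
  doubly_stochastic A ->
  permanent (marcus_minc A) <= n.+2`!%:R / n.+2%:R ^+ n.+2 +
    (n.+2%:R * minor_hi R n - n%:R * minor_lo R n) / 4 * (sqdist A / n.+1%:R ^+ 2).
Proof.
move=> n_gt1 [A_ge0 A_row A_col].
pose x : R := n.+2%:R; have x_gt0 : 0 < x by rewrite ltr0n.
pose y : R := n.+1%:R; have y_gt0 : 0 < y by rewrite ltr0n.
have xE : x = y + 1 by rewrite natr1.
pose u (i : 'I_n.+2) : 'rV[R]_n.+2 := const_mx x^-1.
pose w i := - y^-1 *: (row i A - const_mx x^-1).
pose s := enum 'I_n.+2; pose S := [set: 'I_n.+2].
pose K := (x * minor_hi R n - n%:R * minor_lo R n) / 2.
(* The point at [t] is the transform of [(1 - t) J + t A], again doubly stochastic, so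
   [minor_bounds] applies along the whole segment. *)
have uwE t i : u i + t *: w i =
    y^-1 *: compl_row (const_mx x^-1 + t *: (row i A - const_mx x^-1)).
  apply/rowP => j; rewrite !mxE xE -/y.
  by move: (y) y_gt0 => z z0; field; rewrite !gt_eqF //; lra.
have w_sq : \sum_(i <- s) \sum_(j in S) w i 0 j ^+ 2 = sqdist A / y ^+ 2.
  rewrite sum_enum /sqdist mulr_suml; apply: eq_bigr => i _.
  rewrite sum_setT mulr_suml; apply: eq_bigr => j _.
  by rewrite !mxE mulNr sqrrN exprMn exprVn mulrC.
have cst_sum (c : R) : \sum_(j < n.+2) c = x * c.
  by rewrite sumr_const card_ord -[LHS]mulr_natl.
have w_row i : \sum_(j in S) w i 0 j = 0.
  rewrite sum_setT; under eq_bigr do rewrite !mxE.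
  by rewrite -mulr_sumr sumrB A_row cst_sum mulfV ?gt_eqF // subrr mulr0.
have w_col : \sum_(i <- s) w i = 0.
  apply/rowP => j; rewrite summxE sum_enum; under eq_bigr do rewrite !mxE.
  by rewrite mxE -mulr_sumr sumrB A_col cst_sum mulfV ?gt_eqF // subrr mulr0.
have quad t i k : 0 <= t <= 1 -> i != k ->
    - rper [:: w i - w k, w i - w k & [seq u h + t *: w h | h <- rem k (rem i s)]] S
    <= K * \sum_(j in S) (w i - w k) 0 j ^+ 2.
  move=> /andP[t0 t1] ik.
  have := @rper_quad_le R n.+2 (w i - w k)
    [seq u h + t *: w h | h <- rem k (rem i s)] S (minor_lo R n) (minor_hi R n).
  rewrite cardsT card_ord (_ : n.+2%:R - 2 = n%:R :> R); last first.
    by rewrite -addn2 natrD addrK.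
  apply=> [|j l _ _ jl].
    under eq_bigr => j _ do rewrite mxE [(- w k) 0 j]mxE.
    by rewrite sumrB !w_row subrr.
  rewrite (eq_map (uwE t)); apply: minor_bounds => // [h m|h|m].
  - rewrite !mxE (_ : _ + _ = (1 - t) * x^-1 + t * A h m); last by ring.
    by rewrite addr_ge0 // mulr_ge0 ?subr_ge0 ?invr_ge0 // ltW.
  - under eq_bigr do rewrite !mxE.
    rewrite big_split /= -mulr_sumr sumrB A_row cst_sum mulfV ?gt_eqF //.
    by rewrite subrr mulr0 addr0.
  - under eq_bigr do rewrite !mxE.
    rewrite big_split /= -mulr_sumr sumrB A_col cst_sum mulfV ?gt_eqF //.
    by rewrite subrr mulr0 addr0.
pose g := rper [seq line_row (u i) (w i) | i <- s] S.
pose W := sqdist A / y ^+ 2.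
(* Instead of integrating, this polynomial is shown to be nondecreasing on the unit interval. *)
pose p := (K * W / 2)%:P * 'X^2 - g.
have dp t : t \in `]0, 1[ -> 0 <= p^`().[t].
  rewrite in_itv /= => /andP[t0 t1].
  rewrite /p derivB derivM derivC mul0r add0r derivXn hornerD hornerN.
  rewrite rper_line_deriv ?enum_uniq //.
  have := @rper_replace_row_le R n.+2 _ (fun h => u h + t *: w h) w t K s S
    (enum_uniq _) (ltW t0) w_col.
  rewrite w_sq -/W => H; rewrite subr_ge0.
  have -> : ((K * W / 2)%:P * ('X^(2.-1) *+ 2)).[t] = t * K * W.
    rewrite hornerM hornerC hornerMn hornerXn /= expr1 -mulr_natr.
    by move: (K) (W) => k v; field.
  apply: H => [i k|i k _ _ ik]; last by apply: quad; rewrite // !ltW.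
  by apply/rowP => j; rewrite !mxE; ring.
have := @ler_hornerW R 0 1 p dp 0 1.
rewrite !in_itv /= !lexx ler01 => /(_ isT isT isT).
have pE t : p.[t] = K * W / 2 * t ^+ 2 - rper [seq u i + t *: w i | i <- s] S.
  by rewrite hornerD hornerN rper_line_horner hornerM hornerC hornerXn.
rewrite !pE expr0n expr1n /= mulr0 mulr1.
have -> : rper [seq u i + 0 *: w i | i <- s] S = n.+2`!%:R / x ^+ n.+2.
  have -> : [seq u i + 0 *: w i | i <- s] = nseq #|S| (const_mx x^-1).
    have -> : #|S| = size s by rewrite cardsT card_ord size_enum_ord.
    by elim: (s) => //= i s' ->; rewrite scale0r addr0.
  rewrite rper_nseq cardsT card_ord; under eq_bigr do rewrite mxE.
  by rewrite prodr_const cardsT card_ord exprVn.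
have -> : rper [seq u i + 1 *: w i | i <- s] S = permanent (marcus_minc A).
  rewrite permanent_rper; apply: rper_eq_in => i j _.
  rewrite [RHS]mxE marcus_mincE !mxE.
  rewrite -/x xE [y + 1 - 1]addrK.
  by move: (y) y_gt0 => z z0; field; rewrite !gt_eqF //; lra.
have -> : (n.+2%:R * minor_hi R n - n%:R * minor_lo R n) / 4 *
    (sqdist A / n.+1%:R ^+ 2) = K * W / 2.
  by rewrite -/x -/y -/W /K; move: (_ - _) (W) => k v; field.
move: (K) (W) (permanent _) (_ / _ ^+ n.+2) => k v c0 c1; lra.
Qed.

(** * Numerical comparison of the two bounds from order five on *)

(** Eighth power of [1 - 1/8 <= exp (- 1/8)]; four times the left side exceeds the 1.374 needed in
    [minor_numeric]. *)
Lemma expR_N1_ge (R : realType) : (7 / 8 : R) ^+ 8 <= expR (- 1).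
Proof.
have -> : - 1 = - (1 / 8) * 8%:R :> R by field.
rewrite expRM_natr lerXn2r ?nnegrE ?expR_ge0 //; first by lra.
by apply: le_trans (expR_ge1Dx _); lra.
Qed.

Lemma ratio_pow_ge (R : realType) k : (0 < k)%N ->
  expR (- 1) <= (k%:R / k.+1%:R : R) ^+ k.
Proof.
move=> k0; have kR : 0 < k%:R :> R by rewrite ltr0n.
rewrite -[k%:R / _]invf_div exprVn expRN lef_pV2 ?posrE ?expR_gt0 ?exprn_gt0 ?divr_gt0 //.
rewrite -[X in expR X](mulVf (lt0r_neq0 kR)) expRM_natr.
rewrite lerXn2r ?nnegrE ?expR_ge0 ?divr_ge0 //.
apply: le_trans (expR_ge1Dx _).
by rewrite -natr1 le_eqVlt; apply/orP; left; apply/eqP; field; rewrite gt_eqF.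
Qed.

(** The core of [minor_gap] after common factors are cleared. Small [n] are rational arithmetic;
    from 6 on, the subtracted power is dropped and the power on the right is bounded below through
    [exp (-1)]. *)
Lemma minor_numeric (R : realType) n : (2 < n)%N ->
  (n.+2%:R * (1 / 2 + 2 / n%:R ^+ 2) - n%:R * ((n%:R - 1) / n%:R) ^+ n) *
    (2 * n.+2%:R - 1) < 4 * n.+1%:R ^+ 2 * (n.+1%:R / n.+2%:R) ^+ n.+1 :> R.
Proof.
move=> n2; have [n6|] := leqP 6 n; last first.
  by case: n n2 => [|[|[|[|[|[|n]]]]]] // _ _; lra.
have xE : n.+2%:R = n%:R + 2 :> R by rewrite -addn2 natrD.
have yE : n.+1%:R = n%:R + 1 :> R by rewrite natr1.
have n6R : 6 <= n%:R :> R by rewrite ler_nat.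
have q_ge := le_trans (expR_N1_ge R) (@ratio_pow_ge R n.+1 isT).
have l_ge : 0 <= n%:R * ((n%:R - 1) / n%:R) ^+ n :> R.
  by rewrite mulr_ge0 // exprn_ge0 // divr_ge0 //; lra.
move: q_ge l_ge; set q := (_ / _) ^+ n.+1; set l := n%:R * _ ^+ n.
rewrite xE yE; move: n%:R q l n6R => N q l N6 q_ge l_ge; clear - N6 q_ge l_ge.
have q0 : 1374 / 1000 <= 4 * q by move: q_ge; lra.
apply: le_lt_trans (_ : (N + 2) * (1 / 2 + 2 / N ^+ 2) * (2 * (N + 2) - 1) < _).
  by rewrite ler_pM2r ?lerBlDr ?lerDl //; lra.
apply: lt_le_trans (_ : 1374 / 1000 * (N + 1) ^+ 2 <= _); last first.
  by have := ler_wpM2r (sqr_ge0 (N + 1)) q0; lra.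
have N2 : 0 < N ^+ 2 by rewrite exprn_gt0 //; lra.
rewrite -(ltr_pM2r N2).
have -> : (N + 2) * (1 / 2 + 2 / N ^+ 2) * (2 * (N + 2) - 1) * N ^+ 2 =
    (N + 2) * (N ^+ 2 / 2 + 2) * (2 * (N + 2) - 1).
  by field; rewrite gt_eqF //; lra.
(* Expanded around 6, the difference of the two sides is a polynomial in [M] with nonnegative
   coefficients and a positive constant term. *)
pose M := N - 6; have -> : N = M + 6 by rewrite subrK.
have M0 : 0 <= M by rewrite subr_ge0.
have M2 : 0 <= M ^+ 2 by rewrite exprn_ge0.
have M3 : 0 <= M ^+ 3 by rewrite exprn_ge0.
have M4 : 0 <= M ^+ 4 by rewrite exprn_ge0.
by move: (M) M0 M2 M3 M4 => {}M; lra.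
Qed.

(** The two sides are the coefficients of [sqdist A] in [permanent_marcus_minc_le] and
    [permanent_ge]; the bounds share the same constant term. *)
Lemma minor_gap (R : realType) n : (2 < n)%N ->
  (n.+2%:R * minor_hi R n - n%:R * minor_lo R n) / 4 / n.+1%:R ^+ 2 <
  n.+2`!%:R / n.+2%:R ^+ n.+2 * (2 * n.+2%:R - 1)^-1.
Proof.
move=> n2; have := @minor_numeric R n n2.
rewrite /minor_hi /minor_lo !factS !natrM exprVn [(n.+1%:R / _) ^+ _]expr_div_n.
rewrite [n.+2%:R ^+ n.+2]exprS.
rewrite [n.+1%:R ^+ n.+1]exprS.
set h := _ + _ / _; set l := _ ^+ n; set f := n`!%:R; set Y := n.+1%:R ^+ n.
set X := n.+2%:R ^+ n.+1.
have f_gt0 : 0 < f by rewrite ltr0n fact_gt0.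
have Y_gt0 : 0 < Y by rewrite exprn_gt0 // ltr0n.
have X_gt0 : 0 < X by rewrite exprn_gt0 // ltr0n.
have x1 : 1 < n.+2%:R :> R by rewrite ltr1n.
have y_gt0 : 0 < n.+1%:R :> R by rewrite ltr0n.
move: (n.+2%:R) (n.+1%:R) (n%:R) x1 y_gt0 h l f Y X f_gt0 Y_gt0 X_gt0.
move=> x y N x1 y0 h l f Y X f0 Y0 X0 H; rewrite -subr_gt0.
have x2 : 0 < 2 * x - 1 by clear -x1; lra.
rewrite [X in 0 < X](_ : _ = f / (4 * Y * y ^+ 2 * (2 * x - 1)) *
  (4 * y ^+ 2 * (y * Y / X) - (x * h - N * l) * (2 * x - 1))); last first.
  by field; rewrite !gt_eqF //; clear -x1 x2 y0 Y0; lra.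
rewrite mulr_gt0 ?subr_gt0 // divr_gt0 //.
by rewrite !mulr_gt0 // exprn_gt0.
Qed.

(** * Explicit formulas in orders two, three and four *)

(** With entries indexed by natural numbers, the expanded permanents are polynomials in terms
    [f i j] with numeral indices, ready for [ring] and [field]. *)
Lemma matrix_nat (R : comPzRingType) n (A : 'M[R]_n.+1) :
  A = \matrix_(i, j) A (inord i) (inord j).
Proof. by apply/matrixP => i j; rewrite mxE !inord_val. Qed.

Lemma permanent0 (R : comPzRingType) (A : 'M[R]_0) : permanent A = 1.
Proof. by rewrite permanent_rper (size0nil (size_enum_ord 0)). Qed.

Lemma permanent2 (R : comPzRingType) (f : nat -> nat -> R) :
  permanent (\matrix_(i < 2, j < 2) f i j) =
  f 0%N 0%N * f 1%N 1%N + f 0%N 1%N * f 1%N 0%N.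
Proof.
rewrite !(permanent_expand_row0, big_ord_recl, big_ord0, permanent0, mxE) /=.
ring.
Qed.

Lemma permanent3 (R : comPzRingType) (f : nat -> nat -> R) :
  permanent (\matrix_(i < 3, j < 3) f i j) =
  f 0%N 0%N * (f 1%N 1%N * f 2%N 2%N + f 1%N 2%N * f 2%N 1%N) +
  f 0%N 1%N * (f 1%N 0%N * f 2%N 2%N + f 1%N 2%N * f 2%N 0%N) +
  f 0%N 2%N * (f 1%N 0%N * f 2%N 1%N + f 1%N 1%N * f 2%N 0%N).
Proof.
rewrite !(permanent_expand_row0, big_ord_recl, big_ord0, permanent0, mxE) /=.
ring.
Qed.

Lemma permanent4 (R : comPzRingType) (f : nat -> nat -> R) :
  permanent (\matrix_(i < 4, j < 4) f i j) =
  let minor a b c := f 1%N a * (f 2%N b * f 3%N c + f 2%N c * f 3%N b)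
    + f 1%N b * (f 2%N a * f 3%N c + f 2%N c * f 3%N a)
    + f 1%N c * (f 2%N a * f 3%N b + f 2%N b * f 3%N a) in
  f 0%N 0%N * minor 1%N 2%N 3%N + f 0%N 1%N * minor 0%N 2%N 3%N
  + f 0%N 2%N * minor 0%N 1%N 3%N + f 0%N 3%N * minor 0%N 1%N 2%N.
Proof.
rewrite !(permanent_expand_row0, big_ord_recl, big_ord0, permanent0, mxE) /=.
ring.
Qed.

Lemma marcus_minc_matrix (R : numFieldType) n (f : nat -> nat -> R) :
  marcus_minc (\matrix_(i < n, j < n) f i j) =
  \matrix_(i < n, j < n) ((n%:R - 1)^-1 * (1 - f i j)).
Proof. by apply/matrixP => i j; rewrite marcus_mincE !mxE. Qed.

Lemma doubly_stochastic_nat (R : numDomainType) n (f : nat -> nat -> R) :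
  doubly_stochastic (\matrix_(i < n.+1, j < n.+1) f i j) ->
  [/\ forall i j, (i <= n)%N -> (j <= n)%N -> 0 <= f i j,
      forall i, (i <= n)%N -> \sum_(j < n.+1) f i j = 1
    & forall j, (j <= n)%N -> \sum_(i < n.+1) f i j = 1].
Proof.
move=> [f_ge0 f_row f_col]; split=> [i j lei lej|i lei|j lej].
- by have := f_ge0 (Ordinal (lei : (i < n.+1)%N)) (Ordinal (lej : (j < n.+1)%N)); rewrite mxE.
- rewrite -[RHS](f_row (Ordinal (lei : (i < n.+1)%N))).
  by apply: eq_bigr => j _; rewrite mxE.
- rewrite -[RHS](f_col (Ordinal (lej : (j < n.+1)%N))).
  by apply: eq_bigr => i _; rewrite mxE.
Qed.

Lemma permanent_marcus_minc4 (R : realFieldType) (A : 'M[R]_4) : doubly_stochastic A ->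
  81 * permanent (marcus_minc A) - permanent A =
  15 / 2 + 1 / 2 * sqdist A - 2 / 3 * \sum_i \sum_j (A i j - 4%:R^-1) ^+ 3.
Proof.
rewrite (matrix_nat A); set f := fun i j : nat => A (inord i) (inord j).
rewrite -/(\matrix_(i < 4, j < 4) f i j); move: f => f {A}.
move/doubly_stochastic_nat => [_ f_row f_col].
rewrite marcus_minc_matrix (permanent4 f).
rewrite (permanent4 (fun i j => (4%:R - 1)^-1 * (1 - f i j))) /sqdist.
have r0 := f_row 0%N isT; have r1 := f_row 1%N isT; have r2 := f_row 2%N isT.
have c0 := f_col 0%N isT; have c1 := f_col 1%N isT; have c2 := f_col 2%N isT.
have c3 := f_col 3%N isT.
rewrite !(big_ord_recl, big_ord0, mxE) /= in r0 r1 r2 c0 c1 c2 c3 *.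
have {}r0 : f 0%N 3%N = 1 - f 0%N 0%N - f 0%N 1%N - f 0%N 2%N by move: r0; lra.
have {}r1 : f 1%N 3%N = 1 - f 1%N 0%N - f 1%N 1%N - f 1%N 2%N by move: r1; lra.
have {}r2 : f 2%N 3%N = 1 - f 2%N 0%N - f 2%N 1%N - f 2%N 2%N by move: r2; lra.
have {}c0 : f 3%N 0%N = 1 - f 0%N 0%N - f 1%N 0%N - f 2%N 0%N by move: c0; lra.
have {}c1 : f 3%N 1%N = 1 - f 0%N 1%N - f 1%N 1%N - f 2%N 1%N by move: c1; lra.
have {}c2 : f 3%N 2%N = 1 - f 0%N 2%N - f 1%N 2%N - f 2%N 2%N by move: c2; lra.
have {}c3 : f 3%N 3%N = 1 - f 0%N 3%N - f 1%N 3%N - f 2%N 3%N by move: c3; lra.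
(* [c3] comes first because its right side contains last-column entries, which [r0], [r1] and [r2]
   then eliminate; the nine entries of the leading 3 x 3 block remain free. *)
rewrite c3 r0 r1 r2 c0 c1 c2.
move: (f 0%N 0%N) (f 0%N 1%N) (f 0%N 2%N) (f 1%N 0%N) (f 1%N 1%N) (f 1%N 2%N)
  (f 2%N 0%N) (f 2%N 1%N) (f 2%N 2%N) => x1 x2 x3 x4 x5 x6 x7 x8 x9.
clear; by field.
Qed.

(** For [a + b + c = 1] this is Schur's sum of [a (a - b) (a - c)] over the three variables. *)
Definition schur (R : pzRingType) (a b c : R) : R :=
  1 - 4%:R * (a * b + b * c + c * a) + 9%:R * (a * b * c).

(** With [c] the smallest variable, the expression splits into two nonnegative terms. The first
    vanishes only for [a = b], and then the second only for [c = 0] or [c = a]. *)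
Lemma schur_sorted (R : realFieldType) (a b c : R) :
  0 <= c -> c <= b -> b <= a -> a + b + c = 1 ->
  0 <= schur a b c /\
  (schur a b c = 0 -> (a = 3^-1 /\ b = 3^-1) \/ (a = 2^-1 /\ b = 2^-1)).
Proof.
move=> c0 cb ba abc; have cE : c = 1 - a - b by lra.
have -> : schur a b c = (a - b) ^+ 2 * (a + b - c) + c * ((a - c) * (b - c)).
  by rewrite /schur cE; ring.
have p1 : 0 <= (a - b) ^+ 2 * (a + b - c).
  by rewrite mulr_ge0 ?sqr_ge0 //; lra.
have p2 : 0 <= c * ((a - c) * (b - c)) by rewrite !mulr_ge0 ?subr_ge0 //; lra.
split=> [|s0]; first by rewrite addr_ge0.
have /eqP : (a - b) ^+ 2 * (a + b - c) = 0 by move: p1 p2 s0; lra.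
rewrite mulf_eq0 sqrf_eq0 subr_eq0 => /orP[/eqP ab|/eqP]; last by lra.
have /eqP : c * ((a - c) * (b - c)) = 0 by move: p1 p2 s0; lra.
by rewrite !mulf_eq0 !subr_eq0 => /or3P[/eqP|/eqP|/eqP]; [right|left|left]; lra.
Qed.

Lemma schur_cases (R : realFieldType) (a b c : R) :
  0 <= a -> 0 <= b -> 0 <= c -> a + b + c = 1 ->
  0 <= schur a b c /\
  (schur a b c = 0 -> [\/ a = 3^-1 /\ b = 3^-1, a = 2^-1 /\ b = 2^-1,
    a = 2^-1 /\ b = 0 | a = 0 /\ b = 2^-1]).
Proof.
move=> a0 b0 c0 abc.
have sorted x y z : schur x y z = schur a b c -> x + y + z = 1 -> 0 <= z ->
    z <= y -> y <= x -> 0 <= schur a b c /\ (schur a b c = 0 ->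
    (x = 3^-1 /\ y = 3^-1) \/ (x = 2^-1 /\ y = 2^-1)).
  by move=> <- *; apply: schur_sorted.
have e1 : schur a c b = schur a b c by rewrite /schur; ring.
have e2 : schur b a c = schur a b c by rewrite /schur; ring.
have e3 : schur b c a = schur a b c by rewrite /schur; ring.
have e4 : schur c a b = schur a b c by rewrite /schur; ring.
have e5 : schur c b a = schur a b c by rewrite /schur; ring.
have s1 : a + c + b = 1 by lra.
have s2 : b + a + c = 1 by lra.
have s3 : b + c + a = 1 by lra.
have s4 : c + a + b = 1 by lra.
have s5 : c + b + a = 1 by lra.
have [ab|/ltW ba] := leP a b.
- have [bc|/ltW cb] := leP b c.
    have [s_ge0 s_eq0] := sorted c b a e5 s5 a0 ab bc.
    by split=> // /s_eq0[] [h1 h2]; [constructor 1|constructor 4]; lra.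
  have [ac|/ltW ca] := leP a c.
    have [s_ge0 s_eq0] := sorted b c a e3 s3 a0 ac cb.
    by split=> // /s_eq0[] [h1 h2]; [constructor 1|constructor 4]; lra.
  have [s_ge0 s_eq0] := sorted b a c e2 s2 c0 ca ab.
  by split=> // /s_eq0[] [h1 h2]; [constructor 1|constructor 2]; lra.
- have [ac|/ltW ca] := leP a c.
    have [s_ge0 s_eq0] := sorted c a b e4 s4 b0 ba ac.
    by split=> // /s_eq0[] [h1 h2]; [constructor 1|constructor 3]; lra.
  have [bc|/ltW cb] := leP b c.
    have [s_ge0 s_eq0] := sorted a c b e1 s1 b0 bc ca.
    by split=> // /s_eq0[] [h1 h2]; [constructor 1|constructor 3]; lra.
  have [s_ge0 s_eq0] := sorted a b c erefl abc c0 cb ba.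
  by split=> // /s_eq0[] [h1 h2]; [constructor 1|constructor 2]; lra.
Qed.

Lemma permanent_marcus_minc2 (R : numFieldType) (A : 'M[R]_2) :
  doubly_stochastic A -> permanent (marcus_minc A) = permanent A.
Proof.
rewrite (matrix_nat A); set f := fun i j : nat => A (inord i) (inord j).
rewrite -/(\matrix_(i < 2, j < 2) f i j); move: f => f {A}.
move/doubly_stochastic_nat => [_ f_row f_col].
rewrite marcus_minc_matrix (permanent2 f).
rewrite (permanent2 (fun i j => (2%:R - 1)^-1 * (1 - f i j))).
have := f_row 0%N isT; have := f_row 1%N isT; have := f_col 0%N isT.
rewrite !(big_ord_recl, big_ord0) /= !addr0 => c0 r1 r0.
have -> : f 0%N 1%N = 1 - f 0%N 0%N by rewrite -r0 addrAC subrr add0r.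
have e1 : f 1%N 0%N = 1 - f 0%N 0%N by rewrite -c0 addrAC subrr add0r.
have -> : f 1%N 1%N = 1 - f 1%N 0%N by rewrite -r1 addrAC subrr add0r.
by rewrite e1; field.
Qed.

Lemma permanent_marcus_minc3 (R : numFieldType) (A : 'M[R]_3) :
  doubly_stochastic A -> 4 * (permanent A - permanent (marcus_minc A)) =
  \sum_i schur (A i 0) (A i 1) (A i 2).
Proof.
move=> hA.
have -> : \sum_i schur (A i 0) (A i 1) (A i 2) = \sum_(i < 3)
    schur (A (inord i) (inord 0)) (A (inord i) (inord 1)) (A (inord i) (inord 2)).
  apply: eq_bigr => i _; congr (schur (A _ _) (A _ _) (A _ _));
    by apply: val_inj; rewrite /= inordK.
rewrite {1 2}(matrix_nat A); move: hA; rewrite {1}(matrix_nat A).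
set f := fun i j : nat => A (inord i) (inord j).
rewrite -/(\matrix_(i < 3, j < 3) f i j) => /doubly_stochastic_nat[_ f_row f_col].
under eq_bigr => i _ do rewrite -/(f i 0%N) -/(f i 1%N) -/(f i 2%N).
move: f f_row f_col => f f_row f_col.
rewrite marcus_minc_matrix (permanent3 f).
rewrite (permanent3 (fun i j => (3%:R - 1)^-1 * (1 - f i j))).
have := f_row 0%N isT; have := f_row 1%N isT.
have := f_col 0%N isT; have := f_col 1%N isT; have := f_col 2%N isT.
rewrite !(big_ord_recl, big_ord0) /= => c2 c1 c0 r1 r0.
have {}r0 : f 0%N 2%N = 1 - f 0%N 0%N - f 0%N 1%N by rewrite -r0; ring.
have {}r1 : f 1%N 2%N = 1 - f 1%N 0%N - f 1%N 1%N by rewrite -r1; ring.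
have {}c0 : f 2%N 0%N = 1 - f 0%N 0%N - f 1%N 0%N by rewrite -c0; ring.
have {}c1 : f 2%N 1%N = 1 - f 0%N 1%N - f 1%N 1%N by rewrite -c1; ring.
have {}c2 : f 2%N 2%N = 1 - f 0%N 2%N - f 1%N 2%N by rewrite -c2; ring.
rewrite /schur c2 r0 r1 c0 c1.
by field.
Qed.

(** * Strictness, equality cases and conclusion *)

Lemma marcus_minc_Jmx (R : realFieldType) n : (1 < n)%N -> marcus_minc (Jmx R n) = Jmx R n.
Proof.
move=> n1; have n_gt1 : 1 < n%:R :> R by rewrite ltr1n.
apply/matrixP => i j; rewrite marcus_mincE JmxE; move: n%:R n_gt1 => x x1.
by field; rewrite !gt_eqF //; lra.
Qed.

Lemma sqdist_ge0 (R : realFieldType) n (A : 'M[R]_n) : 0 <= sqdist A.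
Proof. by apply: sumr_ge0 => i _; apply: sumr_ge0 => j _; apply: sqr_ge0. Qed.

Lemma sqdist_eq0 (R : realFieldType) n (A : 'M[R]_n) : sqdist A = 0 -> A = Jmx R n.
Proof.
move=> A0; apply/matrixP => i j; rewrite JmxE; apply/eqP; rewrite -subr_eq0 -sqrf_eq0.
have row_ge0 k : true -> 0 <= \sum_l (A k l - n%:R^-1) ^+ 2.
  by move=> _; apply: sumr_ge0 => l _; apply: sqr_ge0.
have row0 := psumr_eq0P row_ge0 A0 (erefl : xpredT i).
by apply/eqP; apply: (psumr_eq0P _ row0) => // l _; apply: sqr_ge0.
Qed.

Lemma permanent_marcus_minc_lt (R : realType) n (A : 'M[R]_n) : (3 < n)%N ->
  doubly_stochastic A -> A <> Jmx R n -> permanent (marcus_minc A) < permanent A.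
Proof.
move=> n3 hA nJ; have p2_gt0 : 0 < sqdist A.
  by rewrite lt_neqAle eq_sym sqdist_ge0 andbT; apply/eqP => /sqdist_eq0.
case: n A n3 hA nJ p2_gt0 => [|[|[|[|[|n]]]]] // A _ hA _ p2_gt0.
  have := permanent_ge (isT : 1 < 4)%N hA; have := permanent_marcus_minc4 hA.
  (* Nonnegativity of the entries enters here: the cube of [A i j - 1/4] plus a quarter of its
     square is [A i j] times that square. *)
  have : 0 <= \sum_i \sum_j (A i j - 4%:R^-1) ^+ 3 + 1 / 4 * sqdist A.
    rewrite /sqdist mulr_sumr -big_split; apply: sumr_ge0 => i _ /=.
    rewrite mulr_sumr -big_split; apply: sumr_ge0 => j _ /=.
    have [A_ge0 _ _] := hA.
    rewrite [X in 0 <= X](_ : _ = A i j * (A i j - 4%:R^-1) ^+ 2); last by field.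
    by rewrite mulr_ge0 // sqr_ge0.
  move: p2_gt0; set p2 := sqdist A; set p3 := \sum_i _.
  (* The constant terms balance, [80 * 3/32 = 15/2], and the coefficients of [p2] compare strictly:
     [15/14] against [1/2 + 1/6]. *)
  rewrite (_ : 4`! = 24)%N // (_ : 24%:R / 4%:R ^+ 4 = 3 / 32 :> R); last by field.
  rewrite (_ : (2 * 4%:R - 1)^-1 = 1 / 7 :> R); last by field.
  clearbody p2 p3; move: (permanent _) (permanent _) => b a; lra.
have hn : (1 < n.+3)%N by [].
apply: le_lt_trans (permanent_marcus_minc_le hn hA) _.
apply: lt_le_trans (permanent_ge (isT : 1 < n.+4.+1)%N hA).
rewrite mulrDr mulr1 ltrD2l mulrA mulrA.
rewrite [X in X < _](_ : _ = (n.+4.+1%:R * minor_hi R n.+3 - n.+3%:R * minor_lo R n.+3)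
   / 4 / n.+4%:R ^+ 2 * sqdist A); last by rewrite mulrAC.
by rewrite ltr_pM2r // minor_gap.
Qed.

Lemma ord3_ind (P : 'I_3 -> Prop) : P 0 -> P 1 -> P 2 -> forall i, P i.
Proof.
move=> P0 P1 P2 [[|[|[|//]]] lt_i].
- by rewrite (_ : Ordinal _ = 0) //; apply: val_inj.
- by rewrite (_ : Ordinal _ = 1) //; apply: val_inj.
- by rewrite (_ : Ordinal _ = 2) //; apply: val_inj.
Qed.

Lemma sum_ord3 (R : nmodType) (f : 'I_3 -> R) : \sum_i f i = f 0 + f 1 + f 2.
Proof.
rewrite !big_ord_recl big_ord0 addr0 addrA; congr (f _ + f _ + f _);
  exact: val_inj.
Qed.

Lemma permanent_marcus_minc3_ge (R : realFieldType) (A : 'M[R]_3) :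
  doubly_stochastic A -> permanent (marcus_minc A) <= permanent A.
Proof.
move=> hA; rewrite -subr_ge0 -(pmulr_rge0 _ (ltr0Sn R 3)) permanent_marcus_minc3 //.
have [A_ge0 A_row _] := hA; apply: sumr_ge0 => i _.
by have [] := @schur_cases R (A i 0) (A i 1) (A i 2); rewrite ?A_ge0 // -sum_ord3.
Qed.

(** In the forward direction each row is a zero of Schur's expression, so it is constant or has one
    zero and two halves. The column sums forbid mixing the two kinds and forbid two zeros in one
    column, so the zeros, if there are any, form a permutation. *)
Lemma permanent_marcus_minc3_eq (R : realFieldType) (A : 'M[R]_3) :
  doubly_stochastic A ->
  (permanent A = permanent (marcus_minc A) <->
   A = Jmx R 3 \/ exists2 P : 'M[R]_3, is_perm_mx P &
     A = 2^-1 *: (ones R 3 *m (ones R 3)^T - P)).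
Proof.
move=> hA; have [A_ge0 A_row A_col] := hA; split=> [eqAB|]; last first.
  case=> [->|[P /is_perm_mxP[s ->] eA]]; first by rewrite marcus_minc_Jmx.
  have AE i j : A i j = 2^-1 * (1 - (s i == j)%:R).
    by rewrite eA !mxE big_ord1 !mxE mulr1.
  apply/eqP; rewrite -subr_eq0 -(mulrI_eq0 _ (lregP (_ : 4%:R != 0))); last by rewrite pnatr_eq0.
  rewrite permanent_marcus_minc3 // big1 // => i _; rewrite !AE.
  by move: (s i); apply: ord3_ind; rewrite /schur /=; field.
have rows i : (forall j, A i j = 3^-1) \/
    exists j, forall l, A i l = if l == j then 0 else 2^-1.
  have row_sum : A i 0 + A i 1 + A i 2 = 1 by rewrite -sum_ord3.
  have sum0 : \sum_i schur (A i 0) (A i 1) (A i 2) = 0.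
    by rewrite -permanent_marcus_minc3 // eqAB subrr mulr0.
  have schur_ge k : true -> 0 <= schur (A k 0) (A k 1) (A k 2).
    by move=> _; have [] := @schur_cases R (A k 0) (A k 1) (A k 2); rewrite ?A_ge0 // -sum_ord3.
  have s0 := psumr_eq0P schur_ge sum0 (erefl : xpredT i).
  have [//|//|//|//|_ /(_ s0)[] [h0 h1]] := @schur_cases R (A i 0) (A i 1) (A i 2).
  - by left; apply: ord3_ind => //; lra.
  - by right; exists 2; apply: ord3_ind => //=; lra.
  - by right; exists 1; apply: ord3_ind => //=; lra.
  - by right; exists 0; apply: ord3_ind => //=; lra.
have entry_le i j : A i j <= 2^-1.
  case: (rows i) => [->|[k ->]]; first by lra.
  by case: ifP => _; lra.
have col_sum j : A 0 j + A 1 j + A 2 j = 1 by rewrite -(A_col j) sum_ord3.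
(* A column with entries 0 and 1/3 would need 2/3 as its third entry, and one with two zeros would
   need 1; both exceed [entry_le]. *)
have zero_third i i' k : A i k = 0 -> A i' k = 3^-1 -> False.
  have := col_sum k; have := entry_le 0 k; have := entry_le 1 k.
  have := entry_le 2 k; move: i i'.
  by apply: ord3_ind; apply: ord3_ind; lra.
have zero_zero i i' k : A i k = 0 -> A i' k = 0 -> i = i'.
  have := col_sum k; have := entry_le 0 k; have := entry_le 1 k.
  have := entry_le 2 k; move: i i'.
  by apply: ord3_ind; apply: ord3_ind => // *; exfalso; lra.
have [i0 /forallP J0|noJ] := pickP (fun i => [forall j, A i j == 3^-1]).
  left; apply/matrixP => i j; rewrite JmxE; case: (rows i) => [-> //|[k Ai]].
  by exfalso; apply: (@zero_third i i0 k); [rewrite Ai eqxx|apply/eqP].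
right; have zrows i : exists k, forall l, A i l = if l == k then 0 else 2^-1.
  by case: (rows i) => // Ai; have /forallP[] := noJ i => j; rewrite Ai.
have [f Af] := fin_all_exists zrows.
have f_inj : injective f.
  by move=> i i' fii'; apply: (@zero_zero i i' (f i)); rewrite Af ?fii' eqxx.
exists (perm_mx (perm f_inj)); first exact: perm_mx_is_perm.
apply/matrixP => i j; rewrite Af !mxE big_ord1 !mxE mulr1 permE eq_sym.
by case: ifP => _; rewrite ?subrr ?mulr0 // subr0 mulr1.
Qed.

Theorem theorem1p1 (R : realType) (n : nat) (hn : (2 <= n)%N) (A : 'M[R]_n)
    (hA : doubly_stochastic A) :
  permanent (marcus_minc A) <= permanent A /\
  [/\ n = 2%N -> permanent A = permanent (marcus_minc A),
      n = 3%N ->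
        (permanent A = permanent (marcus_minc A) <->
         A = Jmx R n \/
         exists2 P : 'M[R]_n, is_perm_mx P &
           A = 2^-1 *: (ones R n *m (ones R n)^T - P))
    & (4 <= n)%N ->
        (permanent A = permanent (marcus_minc A) <-> A = Jmx R n)].
Proof.
split.
  have [n4|] := leqP 4 n.
    have [->|nJ] := eqVneq A (Jmx R n); first by rewrite marcus_minc_Jmx.
    by apply/ltW/permanent_marcus_minc_lt => //; apply/eqP.
  case: n hn A hA => [|[|[|[|n]]]] // _ A hA _; last exact: permanent_marcus_minc3_ge.
  by rewrite permanent_marcus_minc2.
split=> [n2|n3|n4].
- by subst n; rewrite permanent_marcus_minc2.
- by subst n; apply: permanent_marcus_minc3_eq.
split=> [eqA|->]; last by rewrite marcus_minc_Jmx.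
apply/eqP; case: (eqVneq A (Jmx R n)) => // /eqP nJ.
by have := permanent_marcus_minc_lt n4 hA nJ; rewrite eqA ltxx.
Qed.
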